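(* Under the Setup and the Conditional asymptotic regime described in the context, for $i=0,1$, $$\lim_{p\to\infty} E_{S_n}[\hat\varepsilon_i^B\mid \boldsymbol\mu]=\Phi\!\left((-1)^i\,\frac{-G_i^B+c}{\sqrt{D}}\right),$$ and consequently $$\lim_{p\to\infty} E_{S_n}[\hat\varepsilon^B\mid \boldsymbol\mu]=\alpha_0\,\Phi\!\left(\frac{-G_0^B+c}{\sqrt D}\right)+\alpha_1\,\Phi\!\left(\frac{G_1^B-c}{\sqrt D}\right),$$ where $$G_0^B=\frac{1}{2(1+\gamma_0)}\Big(\gamma_0(\bar\eta_{\mathbf m_0,\boldsymbol\mu_1}-\bar\eta_{\mathbf m_0,\boldsymbol\mu_0})+\bar\delta^2_{\boldsymbol\mu}+(1-\gamma_0)J_0+(1+\gamma_0)J_1\Big),$$ $$G_1^B=\frac{-1}{2(1+\gamma_1)}\Big(\gamma_1(\bar\eta_{\mathbf m_1,\boldsymbol\mu_0}-\bar\eta_{\mathbf m_1,\boldsymbol\mu_1})+\bar\delta^2_{\boldsymbol\mu}+(1-\gamma_1)J_1+(1+\gamma_1)J_0\Big),$$ $$D=\bar\delta^2_{\boldsymbol\mu}+J_0+J_1 .$$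
   Context: Setup. Fix $\alpha_0\in(0,1)$, $\alpha_1=1-\alpha_0$, and $c=\log\frac{1-\alpha_0}{\alpha_0}$. $\Phi$ is the standard normal CDF. For each dimension $p$ there is a known symmetric positive definite $p\times p$ matrix $\Sigma$, class means $\boldsymbol\mu_0,\boldsymbol\mu_1\in\mathbb R^p$, sample sizes $n_0,n_1$, prior means $\mathbf m_0,\mathbf m_1\in\mathbb R^p$ and prior certainty parameters $\nu_0,\nu_1>0$ (all depending on $p$; the index $p$ is suppressed). Class $i$ has distribution $\Pi_i=N(\boldsymbol\mu_i,\Sigma)$. The sample $S_n$ consists of $n_0$ i.i.d. points from $\Pi_0$ and, independently, $n_1$ i.i.d. points from $\Pi_1$; $\bar{\mathbf x}_0,\bar{\mathbf x}_1$ are the class sample means. The LDA classifier assigns $\mathbf x$ to class 1 if $W(\mathbf x)\le c$ and to class 0 otherwise, where $W(\mathbf x)=(\mathbf x-\frac{\bar{\mathbf x}_0+\bar{\mathbf x}_1}{2})^T\Sigma^{-1}(\bar{\mathbf x}_0-\bar{\mathbf x}_1)$. Let $\hat\delta^2=(\bar{\mathbf x}_0-\bar{\mathbf x}_1)^T\Sigma^{-1}(\bar{\mathbf x}_0-\bar{\mathbf x}_1)$. The true error is $\varepsilon=\alpha_0\varepsilon_0+\alpha_1\varepsilon_1$ with $\varepsilon_i=\Phi\Big(\frac{(-1)^{i+1}(\boldsymbol\mu_i-\frac{\bar{\mathbf x}_0+\bar{\mathbf x}_1}{2})^T\Sigma^{-1}(\bar{\mathbf x}_0-\bar{\mathbf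 x}_1)+(-1)^i c}{\hat\delta}\Big)$. The Bayesian MMSE error estimator (for the prior $\boldsymbol\mu_i\sim N(\mathbf m_i,\Sigma/\nu_i)$, $i=0,1$, independent) is $\hat\varepsilon^B=\alpha_0\hat\varepsilon^B_0+\alpha_1\hat\varepsilon^B_1$ with $\hat\varepsilon_i^B=\Phi\Big((-1)^i\frac{-(\mathbf m_i^*-\frac{\bar{\mathbf x}_0+\bar{\mathbf x}_1}{2})^T\Sigma^{-1}(\bar{\mathbf x}_0-\bar{\mathbf x}_1)+c}{\hat\delta}\sqrt{\frac{\nu_i^*}{\nu_i^*+1}}\Big)$, where $\mathbf m_i^*=\frac{n_i\bar{\mathbf x}_i+\nu_i\mathbf m_i}{n_i+\nu_i}$ and $\nu_i^*=n_i+\nu_i$. Notation: $\eta_{\mathbf a,\mathbf b}=(\mathbf a-\mathbf b)^T\Sigma^{-1}(\mathbf a-\mathbf b)$, $\delta^2_{\boldsymbol\mu}=\eta_{\boldsymbol\mu_0,\boldsymbol\mu_1}$; a bar denotes the limit as $p\to\infty$ of the corresponding quantity. Conditional asymptotic regime. $\boldsymbol\mu_0,\boldsymbol\mu_1$ are deterministic for each $p$, and expectations $E_{S_n}[\cdot\mid\boldsymbol\mu]$ are over the sample only. As $p\to\infty$: $n_0,n_1,\nu_0,\nu_1\to\infty$, $p/n_i\to J_i\in[0,\infty)$, $\nu_i/n_i\to\gamma_i\in[0,\infty)$, and for all $i,j\in\{0,1\}$ the quantities $\mathbf m_i^T\Sigma^{-1}\boldsymbol\mu_j$, $\mathbf m_i^T\Sigma^{-1}\mathbf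 m_j$, $\boldsymbol\mu_i^T\Sigma^{-1}\boldsymbol\mu_j$ converge to finite limits (so all the $\eta$'s above converge). It is assumed that $D=\bar\delta^2_{\boldsymbol\mu}+J_0+J_1>0$. $\lim_{p\to\infty}$ denotes the limit along this regime. *)

(* Defs.v *)
From HB Require Import structures.
From mathcomp Require Import all_boot all_order all_algebra.
From mathcomp Require Import all_classical all_reals all_analysis.
Set Implicit Arguments. Unset Strict Implicit. Unset Printing Implicit Defensive.
Import Order.TTheory GRing.Theory Num.Theory.
Import numFieldNormedType.Exports.
Local Open Scope classical_set_scope.
Local Open Scope ring_scope.

Definition Phi {R : realType} (x : R) : R := fine (normal_prob 0 1 `]-oo, x]).

Definition qf {R : realType} {p : nat} (S : 'M[R]_p) (a b : 'cV[R]_p) : R :=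
  (a^T *m invmx S *m b) 0 0.

Definition etaS {R : realType} {p : nat} (S : 'M[R]_p) (a b : 'cV[R]_p) : R :=
  qf S (a - b) (a - b).

Definition sym_pd {R : realType} {p : nat} (S : 'M[R]_p) : Prop :=
  S^T = S /\ forall v : 'cV[R]_p, v != 0 -> 0 < (v^T *m S *m v) 0 0.

(* X is a random vector with distribution N(mu, S): its coordinates are
   measurable and every nonzero linear combination a^T X is (univariate)
   normal with mean a^T mu and variance a^T S a (Cramer-Wold definition). *)
Definition gaussian_vec {R : realType} {d} {T : measurableType d}
  (P : probability T R) {p : nat} (X : T -> 'cV[R]_p) (mu : 'cV[R]_p)
  (S : 'M[R]_p) : Prop :=
  (forall l : 'I_p, measurable_fun setT (fun w => X w l 0)) /\
  forall a : 'cV[R]_p, a != 0 -> forall A : set R, measurable A ->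
    P ((fun w => (a^T *m X w) 0 0) @^-1` A) =
    normal_prob ((a^T *m mu) 0 0) (Num.sqrt ((a^T *m S *m a) 0 0)) A.

(* mutual independence of a finite family of random vectors: product rule
   on (measurable) rectangles, which form a generating pi-system of the
   Borel sets of R^p. *)
Definition indep_vecs {R : realType} {d} {T : measurableType d}
  (P : probability T R) {p : nat} {I : finType} (Y : I -> T -> 'cV[R]_p) : Prop :=
  forall B : I -> 'I_p -> set R, (forall k l, measurable (B k l)) ->
    fine (P [set w | forall k l, B k l (Y k w l 0)]) =
    \prod_(k : I) fine (P [set w | forall l, B k l (Y k w l 0)]).

Definition sample_family {R : realType} {T : Type} {p n0 n1 : nat}
  (X0 : 'I_n0 -> T -> 'cV[R]_p) (X1 : 'I_n1 -> T -> 'cV[R]_p)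
  (k : ('I_n0 + 'I_n1)%type) : T -> 'cV[R]_p :=
  match k with inl j => X0 j | inr j => X1 j end.

Definition smean {R : realType} {T : Type} {p n : nat}
  (X : 'I_n -> T -> 'cV[R]_p) (w : T) : 'cV[R]_p :=
  (n%:R)^-1 *: \sum_(j < n) X j w.

(* Bayesian MMSE class-i error estimator, given the sample means x0, x1;
   (m, nu, n, xi) are the prior mean, prior certainty, sample size and
   sample mean of class i. *)
Definition epsB_i {R : realType} {p : nat} (S : 'M[R]_p) (c : R) (i : bool)
  (m : 'cV[R]_p) (nu : R) (n : nat) (xi x0 x1 : 'cV[R]_p) : R :=
  let mstar := (n%:R + nu)^-1 *: (n%:R *: xi + nu *: m) in
  let nustar := n%:R + nu in
  let dhat := Num.sqrt (qf S (x0 - x1) (x0 - x1)) in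
  Phi ((-1) ^+ i *
       ((- qf S (mstar - 2^-1 *: (x0 + x1)) (x0 - x1) + c) / dhat
        * Num.sqrt (nustar / (nustar + 1)))).

(* Main.v *)
(* Write x_i for the sample means. The argument of Phi in the estimator is a
   continuous function of n_i, nu_i and of the numbers b^T Sigma^-1 x_i and
   x_i^T Sigma^-1 x_j, with b among m_0, m_1, mu_0, mu_1. Each of these converges
   in probability to a constant, by Chebyshev's inequality; as Phi is continuous
   and bounded, the expectations converge. The variances come from the second and
   fourth moments of the linear forms a^T W, W = sum_k c_k (X_k - E X_k): with
   s = sum_k c_k^2 these are s a^T Sigma a and 3 (s a^T Sigma a)^2, by induction
   on the number of independent summands, and polarization then gives that
   W^T Sigma^-1 W has mean s p and variance 2 s^2 p. *)

Require Import Defs.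
From HB Require Import structures.
From mathcomp Require Import all_boot all_order all_algebra.
From mathcomp Require Import all_classical all_reals all_analysis.
From mathcomp Require Import measurable_realfun ring lra.
Set Implicit Arguments. Unset Strict Implicit. Unset Printing Implicit Defensive.
Import Order.TTheory GRing.Theory Num.Theory.
Import numFieldNormedType.Exports.
Local Open Scope classical_set_scope.
Local Open Scope ring_scope.

(** * Expectations *)

(** The law of the sample means is never identified. Adding independent Gaussian vectors would call
    for convolutions, whereas the pair of moments [s v] and [3 (s v) ^ 2] reproduces itself under
    independent addition, because [3 x ^ 2 + 6 x y + 3 y ^ 2 = 3 (x + y) ^ 2]. Moments up to order
    four suffice, since the square of a quadratic form has degree four and a product of four linear
    forms is a signed sum of fourth powers. The price is two inputs: the moments of the normal
    density, and the factorisation of expectations over disjoint parts of the sample, which must be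
    drawn from a product rule stated on rectangles only. The growing dimension leaves its trace in
    the mean [s p]: as [s] is a combination of the inverse sample sizes, [s p] tends to a
    combination of [J0] and [J1], while the variance [2 (s p) s] vanishes. This is the origin of the
    terms in [J0] and [J1] in the limits. *)

(** The integral is a total function, so its value alone does not certify integrability; with both
    recorded, moment identities can be added and scaled freely. [P] is any measure, so that Lebesgue
    measure is covered too. *)
Definition has_mean {R : realType} {d} {T : measurableType d}
  (P : {measure set T -> \bar R}) (X : T -> R) (v : R) : Prop :=
  P.-integrable setT (EFin \o X) /\ (\int[P]_w (X w)%:E = v%:E)%E.

Section has_mean_theory.
Context {R : realType} {d} {T : measurableType d}.
Variable P : {measure set T -> \bar R}.
Implicit Types (X Y : T -> R) (u v : R).

Lemma eq_has_mean {X Y u v} : has_mean P X u -> X =1 Y -> u = v ->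
  has_mean P Y v.
Proof. by move=> h /funext <- <-. Qed.

Lemma has_mean_measurable X v : has_mean P X v -> measurable_fun setT X.
Proof. by move=> [/measurable_int/measurable_EFinP]. Qed.

Lemma has_meanD X Y u v : has_mean P X u -> has_mean P Y v ->
  has_mean P (fun w => X w + Y w) (u + v).
Proof.
move=> [iX eX] [iY eY]; split; first exact: (integrableD measurableT iX iY).
by rewrite [LHS]integralD_EFin// eX eY.
Qed.

Lemma has_meanZ X u k : has_mean P X u -> has_mean P (fun w => k * X w) (k * u).
Proof.
move=> [iX eX]; split; first exact: (integrableZl measurableT k iX).
have := integralZl measurableT iX k.
by rewrite eX -EFinM => <-.
Qed.

Lemma has_mean_sum {I : Type} (s : seq I) (X : I -> T -> R) (v : I -> R) :
  (forall i, has_mean P (X i) (v i)) ->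
  has_mean P (fun w => \sum_(i <- s) X i w) (\sum_(i <- s) v i).
Proof.
move=> h; elim: s => [|i s IH].
  apply: (@eq_has_mean (fun=> 0) _ 0); last 2 first.
  - by move=> w; rewrite big_nil.
  - by rewrite big_nil.
  by split; [exact: integrable0|rewrite integral0].
by apply: (eq_has_mean (has_meanD (h i) IH)) => [w|]; rewrite big_cons.
Qed.

Lemma has_mean_ge0 X u : (forall w, 0 <= X w) -> has_mean P X u -> 0 <= u.
Proof.
by move=> X0 [_ e]; rewrite -lee_fin -e; apply: integral_ge0 => w _; rewrite lee_fin.
Qed.

Lemma chebyshev_has_mean X v (e : R) : 0 < e ->
  has_mean P (fun w => X w ^+ 2) v ->
  (P [set w | e <= `|X w|]%R <= (v / e ^+ 2)%:E)%E.
Proof.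
move=> e0 [iX eX].
have e20 : 0 < e ^+ 2 by rewrite exprn_gt0.
have mX := measurable_int _ iX.
rewrite EFinM lee_pdivlMr// muleC -eX.
have := le_integral_comp_abse P measurableT (f := id) (@measurable_id _ _ _) _ _ mX e20.
move=> /(_ (fun _ => id) (fun _ _ _ _ => id)).
under eq_integral do rewrite /= ger0_norm ?sqr_ge0//.
apply: le_trans; rewrite setTI/= le_eqVlt; apply/orP; left; apply/eqP.
congr (_ * P _)%E; apply/seteqP; split => w /=;
  rewrite lee_fin normrX ler_pXn2r// nnegrE ?ltW//.
Qed.

End has_mean_theory.

Section has_mean_probability.
Context {R : realType} {d} {T : measurableType d}.
Variable P : probability T R.

Lemma has_mean_cst (k : R) : has_mean P (fun=> k) k.
Proof.
split; first exact: finite_measure_integrable_cst.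
by rewrite integral_cst// [X in (_ * X)%E]probability_setT mule1.
Qed.

(** Gives existence without a value, for odd moments that are later multiplied by 0 and for positive
    parts whose means cancel. *)
Lemma has_mean_dominated (X Y : T -> R) (v : R) : measurable_fun setT X ->
  (forall w, `|X w| <= Y w) -> has_mean P Y v -> exists u, has_mean P X u.
Proof.
move=> mX XY [iY _].
have iX : P.-integrable setT (EFin \o X).
  apply: le_integrable iY => //; first exact/measurable_EFinP.
  by move=> w _ /=; rewrite lee_fin (le_trans (XY w))// ler_norm.
exists (fine (\int[P]_w (X w)%:E)); split => //.
by rewrite fineK// integrable_fin_num.
Qed.

End has_mean_probability.

(** * Moments of the normal distribution *)

Lemma ler_norm_1sqr {R : realFieldType} (y : R) : `|y| <= 1 + y ^+ 2.
Proof. by have := sqr_ge0 (y - 1); have := sqr_ge0 (y + 1); rewrite ler_norml; nra. Qed.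

Lemma ler_norm_exp3 {R : realFieldType} (x : R) : `|x ^+ 3| <= 1 + x ^+ 4.
Proof.
have -> : x ^+ 4 = `|x| ^+ 4 by rewrite -normrX ger0_norm// exprn_even_ge0.
rewrite normrX; move: `|x| (normr_ge0 x) => y y0.
have [y1|/ltW y1] := lerP y 1.
  by rewrite (le_trans (exprn_ile1 _ y0 y1))// lerDl exprn_ge0.
by rewrite (le_trans (ler_weXn2l y1 (isT : (3 <= 4)%N)))// lerDr.
Qed.

Section normal_moments.
Context {R : realType}.
Local Notation mu := (@lebesgue_measure R).
Variables (m s : R).
Hypothesis s0 : 0 < s.

Local Notation g := (normal_pdf m s).
Let sn0 : s != 0. Proof. by rewrite gt_eqF. Qed.

Let gE x : g x = normal_peak s * expR (- (x - m) ^+ 2 / (s ^+ 2 *+ 2)).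
Proof. by rewrite normal_pdfE. Qed.

(** The Radon-Nikodym derivative of [normal_prob] and the explicit density have the same integral
    over every measurable set, so they agree almost everywhere. *)
Lemma ge0_integral_normal_prob (f : R -> \bar R) : measurable_fun setT f ->
  (forall x, 0 <= f x)%E ->
  (\int[normal_prob m s]_x f x = \int[mu]_x (f x * (normal_pdf m s x)%:E))%E.
Proof.
move=> mf f0; have dom := normal_prob_dominates m s.
rewrite -(Radon_Nikodym_SigmaFinite.change_of_variables dom)//.
have iRN := Radon_Nikodym_SigmaFinite.f_integrable dom.
have mpdf : measurable_fun setT (EFin \o normal_pdf m s).
  by apply/measurable_EFinP; exact: measurable_normal_pdf.
apply: ae_eq_integral => //.
- by apply: emeasurable_funM => //; exact: measurable_int iRN.
- exact: emeasurable_funM.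
- apply: ae_eqe_mul2l; apply: integral_ae_eq => // E _ mE.
  by rewrite -Radon_Nikodym_SigmaFinite.f_integral.
Qed.

Lemma integral_normal_prob (f : R -> \bar R) : measurable_fun setT f ->
  (\int[normal_prob m s]_x f x = \int[mu]_x (f x * (normal_pdf m s x)%:E))%E.
Proof.
move=> mf; rewrite [LHS]integralE [RHS]integralE.
rewrite ge0_integral_normal_prob//; last exact: measurable_funepos.
rewrite ge0_integral_normal_prob//; last exact: measurable_funeneg.
have g0 x : (0 <= (normal_pdf m s x)%:E)%E by rewrite lee_fin normal_pdf_ge0.
congr (_ - _)%E; apply: eq_integral => x _.
  by rewrite !funeposE maxe_pMl// mul0e.
by rewrite !funenegE maxe_pMl// mul0e mulNe.
Qed.

Lemma is_derive_normal_pdf (x : R) :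
  is_derive x 1 g (- ((x - m) / s ^+ 2) * g x).
Proof.
rewrite normal_pdfE// /normal_fun.
apply: is_derive_eq.
rewrite /GRing.scale/= -(mulr_natr (s ^+ 2)).
move: (expR _) (normal_peak s) => E N; move: sn0; clear; move: s => t t0.
by field.
Qed.

Lemma normal_pdf_sym n : g (m + n) = g (m - n).
Proof.
rewrite !gE (_ : (m + n - m) ^+ 2 = (m - n - m) ^+ 2)//.
by ring.
Qed.

(** With [y = n ^ 2 / (2 s ^ 2)], the exponential factor [exp (- y)] is the square of
    [exp (- y / 2)], which is at most [2 / y]; and [(2 / y) ^ 2 = 16 s ^ 4 / n ^ 4]. *)
Lemma normal_pdf_le n : 0 < n -> g (m + n) <= normal_peak s * (16 * s ^+ 4) / n ^+ 4.
Proof.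
move=> n0; rewrite gE -mulrA ler_wpM2l ?normal_peak_ge0//.
set y := n ^+ 2 / (s ^+ 2 *+ 2).
rewrite (_ : - _ / _ = - (y / 2 + y / 2)); last first.
  by rewrite /y -(mulr_natr (s ^+ 2)); field.
rewrite expRN expRD.
have y0 : 0 < y / 2 by rewrite !mulr_gt0// invr_gt0 pmulrn_lgt0// exprn_gt0.
have h : y / 2 <= expR (y / 2) by rewrite (le_trans _ (expR_ge1Dx _))// lerDr.
rewrite [leRHS](_ : _ = (y / 2 * (y / 2))^-1).
  have yy0 : 0 < y / 2 * (y / 2) by exact: mulr_gt0.
  have ee0 : 0 < expR (y / 2) * expR (y / 2) by rewrite mulr_gt0 ?expR_gt0.
  by rewrite lef_pV2 ?posrE//; apply: ler_pM => //; exact: ltW.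
by rewrite /y -(mulr_natr (s ^+ 2)); field; rewrite sn0 gt_eqF.
Qed.

(** Exponent 3 is the largest that the quartic decay of [normal_pdf_le] absorbs, and the largest
    occurring in the boundary terms of the fourth moment. *)
Lemma pow_normal_pdf_cvg0 k : (k <= 3)%N ->
  (n%:R ^+ k * g (m + n%:R) @[n --> \oo] --> (0 : R)).
Proof.
move=> k3; set C := normal_peak s * (16 * s ^+ 4).
have : (C / n%:R) @[n --> \oo] --> (0 : R).
  rewrite -(mulr0 C); apply: cvgMl_tmp.
  apply/gtr0_cvgV0; last exact: cvgr_idn.
  by near=> n; rewrite ltr0n; near: n; exact: nbhs_infty_gt.
apply: (@squeeze_cvgr _ _ _ _ (fun=> 0)); last exact: cvg_cst.
near=> n.
have n1 : (0 < n)%N by near: n; exact: nbhs_infty_gt.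
have n0 : 0 < n%:R :> R by rewrite ltr0n.
rewrite mulr_ge0 ?exprn_ge0 ?normal_pdf_ge0//=.
apply: (@le_trans _ _ (n%:R ^+ 3 * g (m + n%:R))).
  by rewrite ler_wpM2r ?normal_pdf_ge0// ler_weXn2l// ler1n.
apply: (le_trans (ler_wpM2l _ (normal_pdf_le n0))); first exact: exprn_ge0.
rewrite -/C le_eqVlt; apply/orP; left; apply/eqP.
by field; rewrite gt_eqF.
Unshelve. all: by end_near. Qed.

Let itv (n : nat) : set R := `[m - n%:R, m + n%:R]%classic.

Let bigcup_itv : \bigcup_n itv n = setT.
Proof.
rewrite -subTset => x _.
have [n xn] : exists n : nat, `|x - m| <= n%:R.
  by exists (Num.truncn `|x - m|).+1; rewrite ltW// truncnS_gt.
exists n => //; rewrite /itv/= in_itv/=.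
by rewrite -ler_distl.
Qed.

Let nd_itv : nondecreasing_seq itv.
Proof.
move=> a b ab; apply/subsetPset => x; rewrite /itv/= !in_itv/= -!ler_distl.
by move=> /le_trans; apply; rewrite ler_nat.
Qed.

Let contX k : continuous (fun x : R => (x - m) ^+ k).
Proof.
move=> x; apply: (@continuous_comp _ _ _ (fun x : R => x - m) (fun x => x ^+ k)).
  by apply: cvgB; [exact: cvg_id|exact: cvg_cst].
exact: exprn_continuous.
Qed.

Let contXg k : continuous (fun x : R => (x - m) ^+ k * g x).
Proof.
move=> x; apply: cvgM; last exact: continuous_normal_pdf.
exact: contX.
Qed.

Let measXg k : measurable_fun setT (fun x : R => (x - m) ^+ k * g x).
Proof. by apply: continuous_measurable_fun; exact: contXg. Qed.

Let primitive (x : R) : R := - s ^+ 2 * g x.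

Let is_derive_primitive (x : R) : is_derive x 1 primitive ((x - m) * g x).
Proof.
have := is_derive_normal_pdf x => h; rewrite /primitive; apply: is_derive_eq.
by rewrite /GRing.scale/=; field.
Qed.

Let cont_primitive : continuous primitive.
Proof.
move=> x; have h := is_derive_primitive x.
by apply: differentiable_continuous; apply/derivable1_diffP.
Qed.

(** Integration by parts of [(x - m) ^+ k.+1] against [(x - m) * g x], whose antiderivative is
    [- s ^+ 2 * g x]. This is the truncated form of the recursion between moments of orders [k.+2]
    and [k]. *)
Lemma integral_itv_normal_pdf k n : (0 < n)%N ->
  (\int[mu]_(x in itv n) ((x - m) ^+ k.+2 * g x)%:E =
  (- s ^+ 2 * (n%:R ^+ k.+1 - (- n%:R) ^+ k.+1) * g (m + n%:R))%:E +
  (k.+1%:R * s ^+ 2)%:E * \int[mu]_(x in itv n) ((x - m) ^+ k * g x)%:E)%E.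
Proof.
move=> n0.
have mn : m - n%:R < m + n%:R by rewrite ltrD2l gtrN// ltr0n.
pose F (x : R) : R := (x - m) ^+ k.+1; pose f (x : R) : R := k.+1%:R * (x - m) ^+ k.
pose G := primitive; pose G' (x : R) : R := (x - m) ^+ 1 * g x.
have dF (x : R) : is_derive x 1 F (f x).
  have h : is_derive x 1 (fun x : R => x - m) 1.
    by apply: is_derive_eq; rewrite subr0.
  have hX := is_deriveX k.+1 h.
  have -> : F = (fun x : R => x - m) ^+ k.+1.
    by apply/funext => y; rewrite exprfctE.
  apply: (is_derive_eq hX).
  by rewrite /f /GRing.scale/= mulr1 ?mulr_natl.
have dG (x : R) : is_derive x 1 G (G' x).
  by rewrite /G' expr1; exact: is_derive_primitive.
have cF : continuous F.
  by move=> x; apply: differentiable_continuous; apply/derivable1_diffP.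
have cG : continuous G := cont_primitive.
have e : (\int[mu]_(x in itv n) ((x - m) ^+ k.+2 * g x)%:E =
  \int[mu]_(x in itv n) (F x * G' x)%:E)%E.
  by apply: eq_integral => x _; rewrite /F /G' mulrA expr1 -exprSr.
rewrite e (@integration_by_parts R F G f G' _ _ mn).
- congr (_ + _)%E.
    congr EFin; rewrite /F /G /primitive (addrC m (- _)) addrK (addrC m) addrK addrC.
    rewrite (addrC (- _) m) -normal_pdf_sym; ring.
  have iXg : mu.-integrable (itv n) (fun x => ((x - m) ^+ k * g x)%:E).
    apply: continuous_compact_integrable; first exact: segment_compact.
    exact: continuous_subspaceT.
  rewrite -(integralZl _ iXg); last exact: measurable_itv.
  rewrite -integralN.
    apply: eq_integral => x _; rewrite -EFinM -EFinN; congr EFin.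
    by rewrite /f /G /primitive; ring.
  rewrite fin_num_adde_defl// fin_numN integrable_neg_fin_num//.
  apply: continuous_compact_integrable; first exact: segment_compact.
  apply: continuous_subspaceT.
  have -> : (fun x => f x * G x) = (fun x => (k.+1%:R * - s ^+ 2) * ((x - m) ^+ k * g x)).
    by apply/funext => x; rewrite /f /G /primitive; ring.
  by move=> x; apply: cvgMl_tmp; exact: contXg.
- by apply: continuous_subspaceT => x; apply: cvgMl_tmp; exact: contX.
- by split => [x _||]; [|apply: cvg_at_right_filter; exact: cF|apply: cvg_at_left_filter; exact: cF].
- by move=> x _; rewrite derive1E derive_val.
- have cG' : continuous G' := @contXg 1.
  exact: continuous_subspaceT.
- by split => [x _||]; [|apply: cvg_at_right_filter; exact: cG|apply: cvg_at_left_filter; exact: cG].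
- by move=> x _; rewrite derive1E derive_val.
Qed.

(** For even [k] the integrands are nonnegative, so monotone convergence over the growing windows
    [itv n] applies at both orders; the bound on [k] makes the boundary term vanish. *)
Lemma normal_moment_step k v : ~~ odd k ->
  (k <= 2)%N ->
  (\int[mu]_x ((x - m) ^+ k * g x)%:E = v%:E)%E ->
  (\int[mu]_x ((x - m) ^+ k.+2 * g x)%:E = (k.+1%:R * s ^+ 2 * v)%:E)%E.
Proof.
move=> ek k2 hv.
have pos j : ~~ odd j -> forall x, 0 <= (x - m) ^+ j * g x.
  by move=> ej x; rewrite mulr_ge0 ?normal_pdf_ge0// exprn_even_ge0.
have lim j : ~~ odd j -> (\int[mu]_(x in itv n) ((x - m) ^+ j * g x)%:E @[n --> \oo] -->
    \int[mu]_x ((x - m) ^+ j * g x)%:E)%E.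
  move=> ej; rewrite -bigcup_itv; apply: ge0_nondecreasing_set_cvg_integral => //.
  - by move=> i; exact: measurable_itv.
  - by move=> i; apply/measurable_EFinP/measurable_funTS; exact: measXg.
  - by move=> i x _; rewrite lee_fin pos.
have h2 : ~~ odd k.+2 by rewrite /= negbK.
suff h3 : (\int[mu]_(x in itv n) ((x - m) ^+ k.+2 * g x)%:E @[n --> \oo] -->
    (k.+1%:R * s ^+ 2 * v)%:E)%E by exact: (cvg_unique _ (lim _ h2) h3).
have h1 := lim k ek; rewrite hv in h1.
rewrite -[X in _ --> X]add0e EFinM.
apply: (@cvg_trans _ ((- s ^+ 2 * (n%:R ^+ k.+1 - (- n%:R) ^+ k.+1) * g (m + n%:R))%:E +
  (k.+1%:R * s ^+ 2)%:E * \int[mu]_(x in itv n) ((x - m) ^+ k * g x)%:E @[n --> \oo])%E).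
  apply: near_eq_cvg; near=> n; rewrite integral_itv_normal_pdf//.
  by near: n; exact: nbhs_infty_gt.
apply: cvgeD => //; last by apply: cvgeZl.
apply: cvg_EFin; first by near=> n.
(* As [k.+1] is odd, the contributions of the two endpoints add up instead of cancelling, hence the
   factor 2. *)
rewrite [X in X @ _ --> _](_ : _ = fun n : nat => - s ^+ 2 * 2 * (n%:R ^+ k.+1 * g (m + n%:R))).
  rewrite -[X in _ --> X](mulr0 (- s ^+ 2 * 2)); apply: cvgMl_tmp.
  exact: pow_normal_pdf_cvg0.
apply/funext => n /=; rewrite exprNn -signr_odd/= ek expr1; ring.
Unshelve. all: by end_near. Qed.

Lemma has_mean_normal_even k v : ~~ odd k ->
  (\int[mu]_x ((x - m) ^+ k * g x)%:E = v%:E)%E ->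
  has_mean (normal_prob m s) (fun x => (x - m) ^+ k) v.
Proof.
move=> ek hv.
have mk : measurable_fun setT (fun x : R => (x - m) ^+ k).
  by apply: measurable_funX; exact: measurable_funB.
have pos x : 0 <= (x - m) ^+ k by rewrite exprn_even_ge0.
have e : (\int[normal_prob m s]_x ((x - m) ^+ k)%:E = v%:E)%E.
  rewrite ge0_integral_normal_prob -?hv//; exact/measurable_EFinP.
split => //; apply/integrableP; split; first exact/measurable_EFinP.
under eq_integral do rewrite /= ger0_norm//.
by rewrite e ltry.
Qed.

Lemma normal_moment0 : (\int[mu]_x ((x - m) ^+ 0 * g x)%:E = 1%:E)%E.
Proof.
by rewrite -[RHS](integral_normal_pdf m s); apply: eq_integral => x _; rewrite expr0 mul1r.
Qed.

Lemma has_mean_normal2 :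
  has_mean (normal_prob m s) (fun x => (x - m) ^+ 2) (s ^+ 2).
Proof.
apply: has_mean_normal_even => //.
by rewrite (normal_moment_step _ _ normal_moment0)//; congr EFin; ring.
Qed.

Lemma has_mean_normal4 :
  has_mean (normal_prob m s) (fun x => (x - m) ^+ 4) (3 * s ^+ 4).
Proof.
apply: has_mean_normal_even => //.
rewrite (normal_moment_step _ _ (normal_moment_step _ _ normal_moment0))//.
by congr EFin; ring.
Qed.

(** The integrand changes sign, so dominated convergence replaces monotone convergence. The integral
    over each window centred at [m] is 0, since the antiderivative takes equal values at the
    endpoints. *)
Lemma has_mean_normal1 : has_mean (normal_prob m s) (fun x => x - m) 0.
Proof.
have mX : measurable_fun setT (fun x : R => x - m) by exact: measurable_funB.
have [u hu] : exists u, has_mean (normal_prob m s) (fun x => x - m) u.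
  pose N : probability _ R := normal_prob m s.
  have dom x : `|x - m| <= 1 + (x - m) ^+ 2.
    exact: ler_norm_1sqr.
  exact: (@has_mean_dominated _ _ _ N _ _ _ mX dom (has_meanD (has_mean_cst N 1) has_mean_normal2)).
suff -> : 0 = u by [].
have iN : mu.-integrable setT (fun x => ((x - m) ^+ 2 * g x)%:E).
  apply/integrableP; split; first by apply/measurable_EFinP; exact: measXg.
  have pos x : 0 <= (x - m) ^+ 2 * g x by rewrite mulr_ge0 ?sqr_ge0 ?normal_pdf_ge0.
  under eq_integral do rewrite /= ger0_norm//.
  by rewrite (normal_moment_step _ _ normal_moment0)// ltry.
have hN : has_mean mu (fun x => g x + (x - m) ^+ 2 * g x) (1 + 1%:R * s ^+ 2 * 1).
  apply: has_meanD; split => //; first exact: integrable_normal_pdf.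
    exact: integral_normal_pdf.
  exact: (normal_moment_step _ _ normal_moment0).
have iX : mu.-integrable setT (fun x => ((x - m) * g x)%:E).
  apply: le_integrable hN.1 => //.
    by apply/measurable_EFinP; exact: (measXg 1).
  move=> x _ /=; rewrite lee_fin [leRHS]ger0_norm; last first.
    by apply: addr_ge0; [|apply: mulr_ge0]; rewrite ?sqr_ge0 ?normal_pdf_ge0.
  rewrite normrM (ger0_norm (normal_pdf_ge0 _ _ _)).
  by have := ler_wpM2r (normal_pdf_ge0 m s x) (ler_norm_1sqr (x - m)); rewrite mulrDl mul1r.
have eu : (u%:E = \int[mu]_x ((x - m) * g x)%:E)%E.
  by rewrite -hu.2 integral_normal_prob//; exact/measurable_EFinP.
suff : (\int[mu]_x ((x - m) * g x)%:E = 0)%E by rewrite -eu => -[].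
(* The shift to [n.+1] avoids the degenerate window at 0, where the fundamental theorem of calculus
   does not apply. *)
pose h (n : nat) := (fun x => ((x - m) * g x)%:E) \_ (itv n.+1).
have mXg : measurable_fun setT (fun x : R => ((x - m) * g x)%:E).
  by apply/measurable_EFinP; exact: (measXg 1).
have mitv n : measurable (itv n) by exact: measurable_itv.
have hn n : (\int[mu]_x h n x = 0)%E.
  rewrite -integral_mkcond.
  have cXg : continuous (fun x : R => (x - m) * g x) := @contXg 1.
  have dG := is_derive_primitive.
  rewrite (@continuous_FTC2 _ _ primitive).
  - rewrite /primitive normal_pdf_sym subee//.
  - by rewrite ltrD2l gtrN// ltr0n.
  - exact: continuous_subspaceT.
  - by split => [x _||]; [|apply: cvg_at_right_filter; exact: cont_primitive|apply: cvg_at_left_filter; exact: cont_primitive].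
  - by move=> x _; rewrite derive1E derive_val.
have [||_ _] := @dominated_convergence _ _ _ mu setT measurableT h
  (fun x => ((x - m) * g x)%:E) (fun x => `|(x - m) * g x|%:E)
  (fun n => (measurable_restrictT _ (mitv n.+1)).1 (measurable_funTS mXg))
  mXg _ (integrable_norm iX) _.
- apply: aeW => x _; apply: cvg_near_cst; near=> n.
  rewrite /h patchE ifT// inE /itv/= in_itv/= -ler_distl.
  have : (Num.truncn `|x - m|%R <= n)%N by near: n; exact: nbhs_infty_ge.
  by rewrite -ltnS -(ler_nat R); apply: le_trans; rewrite ltW// truncnS_gt.
- apply: aeW => x n _; rewrite /h patchE; case: ifP => _ //=.
  by rewrite normr0 lee_fin.
under eq_fun do rewrite hn.
by move=> hlim; apply/esym; apply: (cvg_unique _ _ hlim) => //; exact: cvg_cst.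
Unshelve. all: by end_near. Qed.

End normal_moments.

(** * Independence *)

Section independence.
Context {R : realType} {d} {T : measurableType d}.
Variable P : probability T R.

(** For fixed [B], both sides are finite measures in [A]: the restriction of [P] to [B], and [P]
    scaled by [P B]. Agreeing on a pi-system that contains [setT], they agree on the sigma-algebra
    it generates. *)
Lemma pi_system_indep_step (G : set (set T)) (B : set T) : setI_closed G ->
  G setT -> G `<=` measurable -> measurable B ->
  (forall A, G A -> P (A `&` B) = P A * P B)%E ->
  forall A, <<s G >> A -> (P (A `&` B) = P A * P B)%E.
Proof.
move=> GI GT Gm mB GE A sA.
have PBge0 : 0 <= fine (P B) by exact: fine_ge0.
pose m1 := mrestr P mB.
pose m2 := mscale (NngNum PBge0) P.
have m2E C : m2 C = (P C * P B)%E.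
  by rewrite /m2 /mscale/= fineK ?fin_num_measure// muleC.
have -> : (P (A `&` B) = m1 A)%E by [].
rewrite -m2E.
apply: (@g_sigma_algebra_measure_unique _ R T G Gm (fun=> setT)) => //.
- by apply/seteqP; split => // x _; exists 0%N.
- by move=> C GC; rewrite [RHS]m2E -GE.
- by move=> _; rewrite /= /mrestr setTI ltey_eq fin_num_measure.
Qed.

(** The one-sided extension is used twice: inside for each generator of [H], then outside with [A]
    fixed, the sides exchanged by commutativity. *)
Lemma pi_system_indep (G H : set (set T)) : setI_closed G -> setI_closed H ->
  G setT -> H setT -> G `<=` measurable -> H `<=` measurable ->
  (forall A B, G A -> H B -> P (A `&` B) = P A * P B)%E ->
  forall A B, <<s G >> A -> <<s H >> B -> (P (A `&` B) = P A * P B)%E.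
Proof.
move=> GI HI GT HT Gm Hm GH A B sA sB.
have mA : measurable A.
  by move: A sA; apply: smallest_sub => //; exact: sigma_algebra_measurable.
rewrite setIC muleC; apply: (pi_system_indep_step HI HT Hm mA) sB => C HC.
rewrite setIC muleC; apply: (pi_system_indep_step GI GT Gm (Hm _ HC)) sA => D GD.
exact: GH.
Qed.

Definition indep_fun (U V : T -> R) : Prop := forall A B : set R,
  measurable A -> measurable B ->
  (P (U @^-1` A `&` V @^-1` B) = P (U @^-1` A) * P (V @^-1` B))%E.

Lemma indep_fun_comp (U V : T -> R) (f g : R -> R) : indep_fun U V ->
  measurable_fun setT f -> measurable_fun setT g ->
  indep_fun (f \o U) (g \o V).
Proof.
move=> h mf mg A B mA mB; apply: (h (f @^-1` A) (g @^-1` B)).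
- by rewrite -[X in measurable X]setTI; exact: mf.
- by rewrite -[X in measurable X]setTI; exact: mg.
Qed.

(** Independence says that the law of the pair is the product of the two laws; Tonelli's theorem
    then separates the integral. *)
Lemma has_meanM_ge0 (U V : T -> R) (u v : R) : indep_fun U V ->
  (forall w, 0 <= U w) -> (forall w, 0 <= V w) ->
  has_mean P U u -> has_mean P V v -> has_mean P (fun w => U w * V w) (u * v).
Proof.
move=> UV U0 V0 hU hV.
have mU := has_mean_measurable hU; have mV := has_mean_measurable hV.
pose U' : {mfun T >-> R} := HB.pack U (isMeasurableFun.Build _ _ _ _ U mU).
pose V' : {mfun T >-> R} := HB.pack V (isMeasurableFun.Build _ _ _ _ V mV).
have mUV : measurable_fun setT (fun w => (U w, V w)) by exact: measurable_fun_pair.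
pose UV' : {mfun T >-> (R * R)%type} := HB.pack (fun w => (U w, V w)) (isMeasurableFun.Build _ _ _ _ _ mUV).
pose PU := distribution P U'; pose PV := distribution P V'.
pose PUV := distribution P UV'.
have E X : measurable X -> (PU \x PV)%E X = PUV X.
  apply: product_measure_unique => A B mA mB.
  by rewrite -[RHS]UV.
(* [U] and [V] are nonnegative but points of the plane need not be; the absolute values make the
   integrand nonnegative everywhere, as Tonelli requires. *)
pose f (z : R * R) : \bar R := (`|z.1| * `|z.2|)%:E.
have mf : measurable_fun setT f.
  apply/measurable_EFinP; apply: measurable_funM; apply: measurableT_comp => //.
have f0 z : (0 <= f z)%E by rewrite lee_fin mulr_ge0.
have mabs : measurable_fun setT (fun x : R => `|x|%:E).
  by apply/measurable_EFinP; exact: normr_measurable.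
have e : (\int[P]_w (U w * V w)%:E = (u * v)%:E)%E.
  transitivity (\int[PUV]_z f z)%E.
    rewrite ge0_integral_distribution//; apply: eq_integral => w _ /=.
    by rewrite /f/= !ger0_norm.
  transitivity (\int[PU \x PV]_z f z)%E.
    by apply: eq_measure_integral => A mA _; exact/esym/E.
  rewrite fubini_tonelli1//.
  transitivity (\int[PU]_x (`|x|%:E * v%:E))%E.
    apply: eq_integral => x _; rewrite /fubini_F/f/=.
    under eq_integral do rewrite EFinM.
    rewrite ge0_integralZl//; congr (_ * _)%E.
    rewrite (@ge0_integral_distribution _ _ _ _ _ P V')//= -hV.2.
    by apply: eq_integral => w _; rewrite /= ger0_norm.
  rewrite ge0_integralZr//; last by rewrite lee_fin (has_mean_ge0 V0 hV).
  rewrite EFinM; congr (_ * _)%E.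
  rewrite (@ge0_integral_distribution _ _ _ _ _ P U')//= -hU.2.
  by apply: eq_integral => w _; rewrite /= ger0_norm.
split => //; apply/integrableP; split.
  by apply/measurable_EFinP; exact: measurable_funM.
under eq_integral do rewrite /= ger0_norm ?mulr_ge0//.
by rewrite e ltry.
Qed.

(** Positive and negative parts of [U] and [V] are independent as functions of independent
    variables, so the nonnegative case applies to the four products. Their means stay unknown and
    recombine into [u * v]. *)
Lemma has_meanM (U V : T -> R) (u v : R) : indep_fun U V ->
  has_mean P U u -> has_mean P V v -> has_mean P (fun w => U w * V w) (u * v).
Proof.
move=> UV hU hV.
pose p (x : R) := Num.max x 0; pose q (x : R) := Num.max (- x) 0.
have mp : measurable_fun setT p by apply: measurable_maxr.
have mq : measurable_fun setT q by apply: measurable_maxr => //; exact: measurableT_comp.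
have p0 x : 0 <= p x by rewrite le_max lexx orbT.
have q0 x : 0 <= q x by rewrite le_max lexx orbT.
have pq x : x = p x - q x.
  by rewrite /p /q; case: (lerP x 0) => x0; [rewrite max_l|rewrite max_r]; lra.
have habs X x : has_mean P X x -> has_mean P (fun w => `|X w|) (fine (\int[P]_w `|X w|%:E)).
  move=> [iX _]; split; first exact: integrable_norm.
  by rewrite fineK// integrable_fin_num//; exact: integrable_norm.
have hp X x : has_mean P X x -> exists y, has_mean P (p \o X) y.
  move=> hX; apply: has_mean_dominated (habs _ _ hX).
    by apply: measurableT_comp => //; exact: has_mean_measurable hX.
  move=> w; rewrite ger0_norm//= /p; case: (lerP (X w) 0) => h; by [rewrite normr_ge0|rewrite ler_norm].
have hq X x : has_mean P X x -> exists y, has_mean P (q \o X) y.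
  move=> hX; apply: has_mean_dominated (habs _ _ hX).
    by apply: measurableT_comp => //; exact: has_mean_measurable hX.
  move=> w; rewrite ger0_norm//= /q -normrN; case: (lerP (- X w) 0) => h; by [rewrite normr_ge0|rewrite ler_norm].
have [pu hpu] := hp _ _ hU; have [qu hqu] := hq _ _ hU.
have [pv hpv] := hp _ _ hV; have [qv hqv] := hq _ _ hV.
have uniq X x y : has_mean P X x -> has_mean P X y -> x = y.
  by move=> [_ e1] [_ e2]; move: e1; rewrite e2 => -[].
have eu : u = pu + -1 * qu.
  apply: (uniq U) => //; apply: (eq_has_mean (has_meanD hpu (has_meanZ (-1) hqu))) => // w /=.
  by rewrite [RHS]pq mulN1r.
have ev : v = pv + -1 * qv.
  apply: (uniq V) => //; apply: (eq_has_mean (has_meanD hpv (has_meanZ (-1) hqv))) => // w /=.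
  by rewrite [RHS]pq mulN1r.
have h (f g : R -> R) : measurable_fun setT f -> measurable_fun setT g ->
  (forall x, 0 <= f x) -> (forall x, 0 <= g x) -> forall a b,
  has_mean P (f \o U) a -> has_mean P (g \o V) b ->
  has_mean P (fun w => f (U w) * g (V w)) (a * b).
  move=> mf mg f0 g0 a b ha hb.
  by apply: (has_meanM_ge0 (indep_fun_comp UV mf mg)) => // w /=.
have := has_meanD (has_meanD (h _ _ mp mp p0 p0 _ _ hpu hpv) (h _ _ mq mq q0 q0 _ _ hqu hqv))
  (has_meanZ (-1) (has_meanD (h _ _ mp mq p0 q0 _ _ hpu hqv) (h _ _ mq mp q0 p0 _ _ hqu hpv))).
move=> H; apply: (eq_has_mean H) => [w|]; last by rewrite eu ev; ring.
by rewrite [in RHS](pq (U w)) [in RHS](pq (V w)); ring.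
Qed.

End independence.

(** * Independence of functions of disjoint blocks of vectors *)

Section indep_vectors.
Context {R : realType} {d} {T : measurableType d}.
Variables (P : probability T R) (p : nat) (I : finType) (Y : I -> T -> 'cV[R]_p).
Hypothesis mY : forall k l, measurable_fun setT (fun w => Y k w l 0).
Hypothesis iY : indep_vecs P Y.

(** A pi-system generating the sigma-algebra of the vectors with index in [A]. Full sides outside
    [A] let the product rule of [indep_vecs], stated for the whole family, be applied to a block. *)
Definition cylinders (A : pred I) : set (set T) :=
  [set E | exists2 B : I -> 'I_p -> set R,
    (forall k l, measurable (B k l)) /\ (forall k, ~~ A k -> forall l, B k l = setT) &
    E = [set w | forall k l, B k l (Y k w l 0)]].

Lemma cylinders_setI A : setI_closed (cylinders A).
Proof.
move=> _ _ [B [mB BT] ->] [C [mC CT] ->].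
exists (fun k l => B k l `&` C k l); first split.
- by move=> k l; exact: measurableI.
- by move=> k Ak l; rewrite BT// CT// setTI.
- by apply/seteqP; split => w /= => [[b c] k l|bc]; [|split => k l; have [] := bc k l].
Qed.

Lemma cylinders_setT A : cylinders A setT.
Proof. by exists (fun _ _ => setT) => //; apply/seteqP; split. Qed.

Lemma measurable_cylinders A : cylinders A `<=` measurable.
Proof.
move=> _ [B [mB _] ->].
rewrite (_ : mkset _ = \bigcap_(k in setT) \bigcap_(l in setT) ((fun w => Y k w l 0) @^-1` B k l)).
  apply: fin_bigcap_measurable; [exact: finite_finset|move=> k _].
  apply: fin_bigcap_measurable; [exact: finite_finset|move=> l _].
  by rewrite -[X in measurable X]setTI; exact: mY.
by apply/seteqP; split => w /= => [h k _ l _|h k l]; [exact: h|exact: h].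
Qed.

(** [E] and [F] intersect in the rectangle with sides [B k l] and [C k l] intersected. For each
    index at least one of the two families has only full sides, so every factor of the product rule
    splits. *)
Lemma cylinders_indep A A' : (forall k, ~~ (A k && A' k)) ->
  forall E F, cylinders A E -> cylinders A' F -> (P (E `&` F) = P E * P F)%E.
Proof.
move=> AA' E F cE cF.
have mE := measurable_cylinders cE; have mF := measurable_cylinders cF.
rewrite -[LHS]fineK ?fin_num_measure//; last exact: measurableI.
rewrite -[P E]fineK ?fin_num_measure// -[P F]fineK ?fin_num_measure// -EFinM.
congr EFin.
move: cE cF => [B [mB BT] eE] [C [mC CT] eF].
have -> : E `&` F = [set w | forall k l, (B k l `&` C k l) (Y k w l 0)].
  rewrite eE eF.
  by apply/seteqP; split => w /= => [[b c] k l|bc]; [|split => k l; have [] := bc k l].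
rewrite (iY (B := fun k l => B k l `&` C k l)); last by move=> k l; exact: measurableI.
rewrite eE eF (iY mB) (iY mC) -big_split/=; apply: eq_bigr => k _.
have full (D : 'I_p -> set R) : (forall l, D l = setT) ->
    fine (P [set w | forall l, D l (Y k w l 0)]) = 1.
  move=> DT; rewrite (_ : mkset _ = setT) ?probability_setT//.
  by apply/seteqP; split => // w _ l; rewrite DT.
have := AA' k; rewrite negb_and => /orP[/BT h|/CT h].
- rewrite (full _ h) mul1r; congr (fine (P _)).
  by apply/seteqP; split => w /= => [bc l|c l]; [have [] := bc l|split; rewrite ?h//; exact: c].
- rewrite (full _ h) mulr1; congr (fine (P _)).
  by apply/seteqP; split => w /= => [bc l|b l]; [have [] := bc l|split; rewrite ?h//; exact: b].
Qed.

Lemma measurable_coord_cylinders (A : pred I) k l : A k ->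
  measurable_fun setT (fun w : g_sigma_algebraType (cylinders A) => Y k w l 0).
Proof.
move=> Ak _ B mB; rewrite setTI; apply: sub_sigma_algebra.
exists (fun k' l' => if (k' == k) && (l' == l) then B else setT); first split.
- by move=> k' l'; case: ifP.
- by move=> k' nA l'; case: ifP => // /andP[/eqP kk _]; rewrite kk Ak in nA.
- apply/seteqP; split => w /= => [h k' l'|/(_ k l)]; last by rewrite !eqxx.
  by case: ifP => // /andP[/eqP-> /eqP->].
Qed.

(** Measurability for the generated sigma-algebra expresses that [U] depends only on the vectors of
    [A], and [V] only on those of [A']. *)
Lemma indep_vecs_indep_fun (A A' : pred I) (U V : T -> R) :
  (forall k, ~~ (A k && A' k)) ->
  measurable_fun setT (U : g_sigma_algebraType (cylinders A) -> R) ->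
  measurable_fun setT (V : g_sigma_algebraType (cylinders A') -> R) ->
  indep_fun P U V.
Proof.
move=> AA' mU mV B C mB mC.
apply: (pi_system_indep (@cylinders_setI A) (@cylinders_setI A') (@cylinders_setT A)
  (@cylinders_setT A') (@measurable_cylinders A) (@measurable_cylinders A')).
- exact: cylinders_indep.
- by have := mU measurableT _ mB; rewrite setTI.
- by have := mV measurableT _ mC; rewrite setTI.
Qed.

End indep_vectors.

(** * Moments of weighted sums of Gaussian vectors *)

Section law.
Context {R : realType} {d} {T : measurableType d}.
Variable P : probability T R.

Lemma has_mean_law (nu : probability (measurableTypeR R) R) (U : T -> measurableTypeR R)
  (f : R -> R) (v : R) :
  measurable_fun setT U ->
  (forall A, measurable A -> P (U @^-1` A) = nu A) ->
  has_mean nu f v -> has_mean P (f \o U) v.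
Proof.
move=> mU law hf.
have mf := has_mean_measurable hf.
pose U' : {mfun T >-> measurableTypeR R} := HB.pack U (isMeasurableFun.Build _ _ _ _ U mU).
have mfU : measurable_fun setT (f \o U) by exact: measurableT_comp.
have e (g : R -> \bar R) : (\int[distribution P U']_x g x = \int[nu]_x g x)%E.
  by apply: eq_measure_integral => A mA _; exact: law.
have ifU : P.-integrable setT (EFin \o (f \o U)).
  apply/integrableP; split; first exact/measurable_EFinP.
  rewrite -(@ge0_integral_distribution _ _ _ _ _ P U' (fun x => `|(f x)%:E|%E))//; last first.
    by apply/measurable_EFinP; exact: measurableT_comp.
  by rewrite e; have /integrableP[] := hf.1.
split => //; rewrite -(@integral_distribution _ _ _ _ _ P U' (EFin \o f))//; last first.
  exact/measurable_EFinP.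
by rewrite e; exact: hf.2.
Qed.

End law.

Section gaussian_moments.
Context {R : realType} {d} {T : measurableType d}.
Variables (P : probability T R) (p : nat) (S : 'M[R]_p).
Hypothesis pdS : sym_pd S.

Definition centered_form (X : T -> 'cV[R]_p) (M a : 'cV[R]_p) (w : T) : R :=
  (a^T *m (X w - M)) 0 0.

Lemma centered_formE X M a w :
  centered_form X M a w = (a^T *m X w) 0 0 - (a^T *m M) 0 0.
Proof. by rewrite /centered_form mulmxBr !mxE. Qed.

Lemma measurable_form d' (T' : measurableType d') (X : T' -> 'cV[R]_p) (a : 'cV[R]_p) :
  (forall l, measurable_fun setT (fun w => X w l 0)) ->
  measurable_fun setT (fun w => (a^T *m X w) 0 0).
Proof.
move=> mX; under eq_fun do rewrite mxE.
by apply: measurable_sum => l; apply: measurable_funM.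
Qed.

Lemma centered_form_moments X M a : gaussian_vec P X M S ->
  [/\ has_mean P (centered_form X M a) 0,
      has_mean P (fun w => centered_form X M a w ^+ 2) ((a^T *m S *m a) 0 0) &
      has_mean P (fun w => centered_form X M a w ^+ 4) (3 * (a^T *m S *m a) 0 0 ^+ 2)].
Proof.
(* [gaussian_vec] speaks of nonzero [a] only; for [a = 0] the form is identically 0. Otherwise
   positive definiteness gives the positive standard deviation that the normal moments need. *)
move=> [mX gX]; have [a0|a0] := eqVneq a 0.
  have f0 w : centered_form X M a w = 0.
    by rewrite /centered_form a0 trmx0 mul0mx mxE.
  have -> : (a^T *m S *m a) 0 0 = 0 by rewrite a0 mulmx0 mxE.
  have h0 := has_mean_cst P 0.
  by split; apply: (eq_has_mean h0) => [w|]; rewrite ?f0//; ring.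
have v0 := pdS.2 _ a0; have := gX _ a0.
set v := (_ *m a) 0 0 in v0 *; set m := (_ *m M) 0 0 => law.
have s0 : 0 < Num.sqrt v by rewrite sqrtr_gt0.
have s2 : Num.sqrt v ^+ 2 = v by rewrite sqr_sqrtr// ltW.
have mU := measurable_form a mX.
split.
- apply: (eq_has_mean (has_mean_law mU law (has_mean_normal1 _ s0))) => // w.
  by rewrite centered_formE.
- apply: (eq_has_mean (has_mean_law mU law (has_mean_normal2 _ s0))) => // w.
  by rewrite centered_formE.
- apply: (eq_has_mean (has_mean_law mU law (has_mean_normal4 _ s0))) => [w|].
    by rewrite centered_formE.
  by rewrite -[in RHS]s2; ring.
Qed.

Variables (I : finType) (X : I -> T -> 'cV[R]_p) (M : I -> 'cV[R]_p) (c : I -> R).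
Hypothesis gX : forall k, gaussian_vec P (X k) (M k) S.
Hypothesis iX : indep_vecs P X.

(** Splitting off one index, with [U] the new form and [W] the rest: the odd cross terms contain a
    factor of mean 0, and [3 c ^ 4 v ^ 2 + 6 c ^ 2 v (s v) + 3 (s v) ^ 2 = 3 ((c ^ 2 + s) v) ^ 2].
    Since [r] has no repetition, [U] and [W] depend on disjoint blocks. *)
Lemma weighted_form_moments (a : 'cV[R]_p) (r : seq I) : uniq r ->
  let W w := \sum_(k <- r) c k * centered_form (X k) (M k) a w in
  let s := \sum_(k <- r) c k ^+ 2 in let v := (a^T *m S *m a) 0 0 in
  [/\ has_mean P W 0, has_mean P (fun w => W w ^+ 2) (s * v) &
      has_mean P (fun w => W w ^+ 4) (3 * (s * v) ^+ 2)].
Proof.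
move=> + W0 s0 v; rewrite {}/W0 {}/s0.
elim: r => [|k r IH] /=.
  move=> _; have h0 := has_mean_cst P 0.
  by split; apply: (eq_has_mean h0) => [w|]; rewrite ?big_nil//; ring.
case/andP => kr /IH []; set W := fun w => \sum_(k <- r) _; set s := \sum_(k <- r) _.
move=> W1 W2 W4.
have [X1 X2 X4] := centered_form_moments a (gX k).
set U := centered_form (X k) (M k) a in X1 X2 X4; rewrite -/v in X2 X4.
have mX k' l : measurable_fun setT (fun w => X k' w l 0) by have [] := gX k'.
have UW : indep_fun P U W.
  apply: (indep_vecs_indep_fun mX iX (A := pred1 k) (A' := [pred k' | k' \in r])).
  - by move=> k' /=; apply/negP => /andP[/eqP-> h]; rewrite h in kr.
  - rewrite (_ : (U : _ -> R) = fun w => (a^T *m X k w) 0 0 - (a^T *m M k) 0 0).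
      apply: measurable_funB => //; apply: measurable_form => l.
      by apply: measurable_coord_cylinders; rewrite /= eqxx.
    by apply/funext => w; exact: centered_formE.
  (* The guard makes every summand, whatever its index, measurable for the block of [r], as the
     measurability of a sum asks. *)
  - rewrite (_ : (W : _ -> R) = fun w => \sum_(k' <- r) (if k' \in r then
        c k' * ((a^T *m X k' w) 0 0 - (a^T *m M k') 0 0) else 0)).
      apply: measurable_sum => k'; have [k'r|_] := boolP (k' \in r); last exact: measurable_cst.
      apply: measurable_funM => //; apply: measurable_funB => //.
      by apply: measurable_form => l; apply: measurable_coord_cylinders.
    apply/funext => w; rewrite /W big_seq [RHS]big_seq; apply: eq_bigr => k' ->.
    by rewrite centered_formE.
(* The third moments occur only next to a first moment equal to 0, so their existence is enough. *)
have cub Z z : has_mean P Z 0 -> has_mean P (fun w => Z w ^+ 4) z ->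
    exists t, has_mean P (fun w => Z w ^+ 3) t.
  move=> Z1 Z4; apply: has_mean_dominated (has_meanD (has_mean_cst P 1) Z4).
    by apply: measurable_funX; exact: has_mean_measurable Z1.
  by move=> w; exact: ler_norm_exp3.
have [u3 U3] := cub _ _ X1 X4; have [w3 W3] := cub _ _ W1 W4.
have mexp n : measurable_fun setT (fun x : R => x ^+ n) by exact: measurable_funX.
have prod i j a1 a2 (h1 : has_mean P (fun w => U w ^+ i) a1)
    (h2 : has_mean P (fun w => W w ^+ j) a2) :
    has_mean P (fun w => U w ^+ i * W w ^+ j) (a1 * a2).
  exact: (has_meanM (indep_fun_comp UW (mexp i) (mexp j))).
have U1 : has_mean P (fun w => U w ^+ 1) 0 by exact: X1.
have V1 : has_mean P (fun w => W w ^+ 1) 0 by exact: W1.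
split.
- apply: (eq_has_mean (has_meanD (has_meanZ (c k) X1) W1)) => [w|]; last by ring.
  by rewrite big_cons.
- apply: (eq_has_mean (has_meanD (has_meanD (has_meanZ (c k ^+ 2) X2) W2)
    (has_meanZ (2 * c k) (prod _ _ _ _ U1 V1)))) => [w|].
    by rewrite big_cons -/(W w) -/(U w); ring.
  by rewrite big_cons -/s; ring.
- apply: (eq_has_mean (has_meanD (has_meanD (has_meanD (has_meanD
    (has_meanZ (c k ^+ 4) X4) W4)
    (has_meanZ (4 * c k ^+ 3) (prod _ _ _ _ U3 V1)))
    (has_meanZ (4 * c k) (prod _ _ _ _ U1 W3)))
    (has_meanZ (6 * c k ^+ 2) (prod _ _ _ _ X2 W2)))) => [w|].
    by rewrite big_cons -/(W w) -/(U w); ring.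
  by rewrite big_cons -/s; ring.
Qed.

End gaussian_moments.

(** * Bilinear algebra of [S] and its inverse *)

Section quadratic_form.
Context {R : realType} {p : nat}.
Variable S : 'M[R]_p.
Hypothesis pdS : sym_pd S.

Definition covf (a b : 'cV[R]_p) : R := (a^T *m S *m b) 0 0.

Lemma sym_pd_unitmx : S \in unitmx.
Proof.
rewrite unitmxE unitfE; apply/eqP => /eqP /det0P[v v0 vS].
have := pdS.2 v^T; rewrite trmx_eq0 => /(_ v0).
by rewrite trmxK vS mul0mx mxE ltxx.
Qed.

Lemma trmx_invmx_sym_pd : (invmx S)^T = invmx S.
Proof. by rewrite trmx_inv pdS.1. Qed.

Lemma covfC a b : covf a b = covf b a.
Proof.
transitivity (((a^T *m S *m b)^T) 0 0); first by rewrite mxE.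
by rewrite !trmx_mul trmxK pdS.1 mulmxA.
Qed.

Lemma covfDl a b c : covf (a + b) c = covf a c + covf b c.
Proof. by rewrite /covf linearD/= !mulmxDl mxE. Qed.

Lemma covfZl k a b : covf (k *: a) b = k * covf a b.
Proof. by rewrite /covf linearZ/= -!scalemxAl mxE. Qed.

Lemma covfDr a b c : covf c (a + b) = covf c a + covf c b.
Proof. by rewrite covfC covfDl !(covfC _ c). Qed.

Lemma covfZr k a b : covf b (k *: a) = k * covf b a.
Proof. by rewrite covfC covfZl covfC. Qed.

Lemma covf_invr a b : covf a (invmx S *m b) = (a^T *m b) 0 0.
Proof. by rewrite /covf mulmxA mulmxK// sym_pd_unitmx. Qed.

Lemma qfC (a b : 'cV[R]_p) : qf S a b = qf S b a.
Proof.
transitivity (((a^T *m invmx S *m b)^T) 0 0); first by rewrite mxE.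
by rewrite !trmx_mul trmxK trmx_invmx_sym_pd mulmxA.
Qed.

Lemma qfDl (a b c : 'cV[R]_p) : qf S (a + b) c = qf S a c + qf S b c.
Proof. by rewrite /qf linearD/= !mulmxDl mxE. Qed.

Lemma qfZl k (a b : 'cV[R]_p) : qf S (k *: a) b = k * qf S a b.
Proof. by rewrite /qf linearZ/= -!scalemxAl mxE. Qed.

Lemma qfDr (a b c : 'cV[R]_p) : qf S c (a + b) = qf S c a + qf S c b.
Proof. by rewrite qfC qfDl !(qfC _ c). Qed.

Lemma qfNl (a b : 'cV[R]_p) : qf S (- a) b = - qf S a b.
Proof. by rewrite -scaleN1r qfZl mulN1r. Qed.

Lemma qfNr (a b : 'cV[R]_p) : qf S b (- a) = - qf S b a.
Proof. by rewrite qfC qfNl qfC. Qed.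

Lemma qf_form (a b : 'cV[R]_p) : qf S a b = ((invmx S *m a)^T *m b) 0 0.
Proof. by rewrite trmx_mul trmx_invmx_sym_pd. Qed.

Let e (i : 'I_p) : 'cV[R]_p := delta_mx i 0.

(* [e i] and [invmx S *m e i] are dual for [covf], so that the moments of the
   quadratic form can be computed without a square root of [S]. *)
Lemma qf_dual_basis (x : 'cV[R]_p) :
  qf S x x = \sum_i ((e i)^T *m x) 0 0 * ((invmx S *m e i)^T *m x) 0 0.
Proof.
rewrite /qf -mulmxA mxE; apply: eq_bigr => i _.
rewrite trmx_mul trmx_invmx_sym_pd -mulmxA trmx_delta -!rowE !mxE.
by [].
Qed.

Lemma covf_basis i j : covf (e i) (e j) = S i j.
Proof. by rewrite /covf trmx_delta -rowE -colE !mxE. Qed.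

Lemma covf_basis_dual i j : covf (e i) (invmx S *m e j) = (i == j)%:R.
Proof. by rewrite covf_invr trmx_delta -rowE !mxE eqxx andbT. Qed.

Lemma covf_dual i j : covf (invmx S *m e i) (invmx S *m e j) = invmx S i j.
Proof.
by rewrite covf_invr trmx_mul trmx_invmx_sym_pd trmx_delta -mulmxA -rowE -colE !mxE.
Qed.

(** By symmetry of [invmx S], the double sum is the trace of [S *m invmx S], an identity matrix. *)
Lemma sum_dual_basis : \sum_i \sum_j S i j * invmx S i j = p%:R.
Proof.
transitivity (\tr (S *m invmx S)); last by rewrite mulmxV ?sym_pd_unitmx// mxtrace1.
apply: eq_bigr => i _; rewrite mxE; apply: eq_bigr => j _.
by rewrite -[in RHS]trmx_invmx_sym_pd mxE.
Qed.

End quadratic_form.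

(** * From moments of linear forms to moments of the quadratic form *)

Section gaussian_quadratic.
Context {R : realType} {d} {T : measurableType d}.
Variables (P : probability T R) (p : nat) (S : 'M[R]_p).
Hypothesis pdS : sym_pd S.
Variables (W : T -> 'cV[R]_p) (s : R).
Let L (a : 'cV[R]_p) w : R := (a^T *m W w) 0 0.
Hypothesis L2 : forall a, has_mean P (fun w => L a w ^+ 2) (s * covf S a a).
Hypothesis L4 : forall a, has_mean P (fun w => L a w ^+ 4) (3 * (s * covf S a a) ^+ 2).

Let LD a b w : L (a + b) w = L a w + L b w.
Proof. by rewrite /L linearD/= mulmxDl mxE. Qed.

Let LZ k a w : L (k *: a) w = k * L a w.
Proof. by rewrite /L linearZ/= -scalemxAl mxE. Qed.

Lemma has_mean_form2 a b : has_mean P (fun w => L a w * L b w) (s * covf S a b).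
Proof.
apply: (eq_has_mean (has_meanZ 2^-1 (has_meanD (L2 (a + b))
  (has_meanZ (-1) (has_meanD (L2 a) (L2 b)))))) => [w|].
  by rewrite LD; field.
by rewrite (covfDr pdS) !covfDl (covfC pdS b a); field.
Qed.

Lemma has_mean_form4 a b c e : has_mean P (fun w => L a w * L b w * L c w * L e w)
  (s ^+ 2 * (covf S a b * covf S c e + covf S a c * covf S b e + covf S a e * covf S b c)).
Proof.
(* Polarization: 192 A B C E is the signed sum of the (A +- B +- C +- E)^4. *)
pose u x y z := a + x *: b + y *: c + z *: e.
have h x y z := has_meanZ (x * y * z / 192) (L4 (u x y z)).
have Lu x y z w : L (u x y z) w = L a w + x * L b w + y * L c w + z * L e w.
  by rewrite /u !LD !LZ.
have vu x y z : covf S (u x y z) (u x y z) =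
  covf S a a + x ^+ 2 * covf S b b + y ^+ 2 * covf S c c + z ^+ 2 * covf S e e
  + 2 * (x * covf S a b + y * covf S a c + z * covf S a e + x * y * covf S b c
     + x * z * covf S b e + y * z * covf S c e).
  rewrite /u !(covfDr pdS) !covfDl !(covfZr pdS) !covfZl.
  rewrite (covfC pdS b a) (covfC pdS c a) (covfC pdS c b) (covfC pdS e a) (covfC pdS e b) (covfC pdS e c).
  by ring.
apply: (eq_has_mean (has_meanD (has_meanD (has_meanD (h 1 1 1) (h 1 1 (-1)))
    (has_meanD (h 1 (-1) 1) (h 1 (-1) (-1))))
  (has_meanD (has_meanD (h (-1) 1 1) (h (-1) 1 (-1)))
    (has_meanD (h (-1) (-1) 1) (h (-1) (-1) (-1)))))) => [w|].
  rewrite !Lu; move: (L a w) (L b w) (L c w) (L e w) => A B C E; by field.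
rewrite !vu; move: (covf S a a) (covf S b b) (covf S c c) (covf S e e) (covf S a b)
  (covf S a c) (covf S a e) (covf S b c) (covf S b e) (covf S c e) => *; by field.
Qed.

(** The three pairings in [has_mean_form4], summed over the dual bases, give [p ^ 2], [p] (the trace
    in [sum_dual_basis]) and [p] (the diagonal). Subtracting the squared mean [(s p) ^ 2] leaves
    [2 p s ^ 2]. *)
Lemma has_mean_qf_sqr :
  has_mean P (fun w => (qf S (W w) (W w) - s * p%:R) ^+ 2) (2 * p%:R * s ^+ 2).
Proof.
pose e (i : 'I_p) : 'cV[R]_p := delta_mx i 0; pose f i := invmx S *m e i.
have h1 := has_mean_sum (index_enum 'I_p) (fun i => has_mean_form2 (e i) (f i)).
have h2 := has_mean_sum (index_enum 'I_p) (fun i => has_mean_sum (index_enum 'I_p) (fun j =>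
  has_mean_form4 (e i) (f i) (e j) (f j))).
apply: (eq_has_mean (has_meanD (has_meanD h2 (has_meanZ (- 2 * (s * p%:R)) h1))
   (has_mean_cst P ((s * p%:R) ^+ 2)))) => [w|].
  have Q : qf S (W w) (W w) = \sum_i L (e i) w * L (f i) w by exact: qf_dual_basis.
  have -> : \sum_i \sum_j L (e i) w * L (f i) w * L (e j) w * L (f j) w = qf S (W w) (W w) ^+ 2.
    rewrite Q expr2 big_distrl/=; apply: eq_bigr => i _.
    by rewrite big_distrr/=; apply: eq_bigr => j _; rewrite mulrA.
  by rewrite -Q; ring.
have -> : \sum_i s * covf S (e i) (f i) = s * p%:R.
  under eq_bigr do rewrite (covf_basis_dual pdS) eqxx mulr1.
  by rewrite sumr_const card_ord mulr_natr.
have -> : \sum_i \sum_j s ^+ 2 * (covf S (e i) (f i) * covf S (e j) (f j) +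
    covf S (e i) (e j) * covf S (f i) (f j) + covf S (e i) (f j) * covf S (f i) (e j)) =
    s ^+ 2 * (p%:R ^+ 2 + p%:R + p%:R).
  transitivity (\sum_(i < p) \sum_(j < p)
    s ^+ 2 * (1 + S i j * invmx S i j + (i == j)%:R)).
    apply: eq_bigr => i _; apply: eq_bigr => j _.
    rewrite (covfC pdS (f i) (e j)) !(covf_basis_dual pdS) covf_basis (covf_dual pdS).
    rewrite !eqxx mulr1 [j == i]eq_sym.
    by case: (i == j); rewrite ?mulr1 ?mulr0.
  under eq_bigr do rewrite -big_distrr/= !big_split/=.
  rewrite -big_distrr/= !big_split/= (sum_dual_basis pdS); congr (_ * (_ + _ + _)).
    by rewrite !sumr_const card_ord -[LHS]mulr_natr -expr2.
  rewrite -[in RHS](card_ord p) -sumr_const; apply: eq_bigr => i _.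
  rewrite (bigD1 i)//= eqxx big1 ?addr0// => j.
  by rewrite eq_sym => /negbTE ->.
by ring.
Qed.

Lemma has_mean_qf_linear (b : 'cV[R]_p) :
  has_mean P (fun w => qf S b (W w) ^+ 2) (s * qf S b b).
Proof.
apply: (eq_has_mean (L2 (invmx S *m b))) => [w|].
  by rewrite /L -(qf_form pdS).
by rewrite (covf_invr pdS) -(qf_form pdS).
Qed.

End gaussian_quadratic.

(** * Convergence in probability *)

Section convergence_in_probability.
Context {R : realType} {d} {T : measurableType d}.
Variable P : probability T R.

(* A function on [nat * T] converges along this filter iff the corresponding
   sequence of random variables converges in probability; limits in probability
   thus inherit the whole limit calculus (sums, products, continuous maps). *)
Definition prob_filter : set_system (nat * T) :=
  [set A | exists2 B : nat -> set T, (forall p, measurable (B p)) /\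
     (fun p => P (B p)) @ \oo --> 0%E & forall p w, ~ B p w -> A (p, w)].

Global Instance prob_filter_filter : Filter prob_filter.
Proof.
split.
- exists (fun=> set0) => //; split => //.
  by under eq_fun do rewrite measure0; exact: cvg_cst.
- move=> A A' [B [mB cB] BA] [C [mC cC] CA].
  exists (fun p => B p `|` C p); first split.
  + by move=> p; exact: measurableU.
  + apply: (@squeeze_cvge _ _ _ _ (fun=> 0%E) _ (fun p => P (B p) + P (C p))%E).
    * by apply: nearW => p; rewrite measure_ge0 measureU2.
    * exact: cvg_cst.
    * by rewrite -[X in _ --> X](adde0 0%E); apply: cvgeD.
  + by move=> p w /not_orP[/BA ? /CA ?].
- by move=> A A' AA' [B hB BA]; exists B => // p w /BA /AA'.
Qed.

Lemma prob_filter_fst : fst @ prob_filter --> \oo.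
Proof.
(* The exceptional set may be everything before [N], because only the tail of its probabilities
   matters. *)
move=> A [N _ NA]; exists (fun p => if (N <= p)%N then set0 else setT); first split.
- by move=> p; case: ifP.
- apply: cvg_near_cst; near=> p.
  by rewrite ifT ?measure0//; near: p; exact: nbhs_infty_ge.
- by move=> p w; case: ifP => [Np _|_ /(_ I)//]; exact: NA.
Unshelve. all: by end_near. Qed.

Lemma cvg_prob_seq (U : topologicalType) (u : nat -> U) (l : U) :
  u @ \oo --> l -> (fun z => u z.1) @ prob_filter --> l.
Proof. by move=> ul; exact: (cvg_comp _ _ prob_filter_fst ul). Qed.

(** The centring [l p] moves with [p], as the mean [s p] does. The moment is required only for large
    [p], since sample sizes may be 0 before. *)
Lemma cvg_prob_chebyshev (f : nat -> T -> R) (l : nat -> R) (v : nat -> R) (l' : R) :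
  (forall p, measurable_fun setT (f p)) ->
  (\forall p \near \oo, has_mean P (fun w => (f p w - l p) ^+ 2) (v p)) ->
  v @ \oo --> 0 -> l @ \oo --> l' ->
  (fun z => f z.1 z.2) @ prob_filter --> l'.
Proof.
move=> mf fl v0 ll.
suff h : (fun z => f z.1 z.2 - l z.1) @ prob_filter --> (0 : R).
  rewrite -[l']add0r (_ : (fun z => _) = (fun z => (f z.1 z.2 - l z.1) + l z.1)).
    by apply: cvgD => //; exact: cvg_prob_seq.
  by apply/funext => z; rewrite subrK.
apply/cvgr0Pnorm_lt => e e0.
exists (fun p => [set w | e <= `|f p w - l p|]); last first.
  by move=> p w /= /negP; rewrite -ltNge.
split.
  move=> p; rewrite -[X in measurable X]setTI.
  rewrite (_ : mkset _ = (fun w => `|f p w - l p|) @^-1` `[e, +oo[).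
    apply: (@measurableT_comp _ _ _ _ _ _ _ _ (fun w => f p w - l p)) => //.
    exact: measurable_funB.
  by apply/seteqP; split => w /=; rewrite in_itv/= andbT.
apply: (@squeeze_cvge _ _ _ _ (fun=> 0%E) _ (fun p => (v p / e ^+ 2)%:E)).
- near=> p; rewrite measure_ge0/=; apply: (@chebyshev_has_mean _ _ _ _ (fun w => f p w - l p)) => //.
  by near: p.
- exact: cvg_cst.
- apply: cvg_EFin; first exact: nearW.
  by rewrite -[X in _ --> X](mul0r (e ^+ 2)^-1); apply: cvgMr_tmp.
Unshelve. all: by end_near. Qed.

(** The distance to [l] is at most [e / 2] off an exceptional set and at most 1 on it, both values
    lying in the unit interval. Integrating this bound leaves [e / 2] plus a probability that tends
    to 0. *)
Lemma bounded_cvg_prob_expectation (f : nat -> T -> R) (l : R) :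
  (forall p, measurable_fun setT (f p)) -> (forall p w, 0 <= f p w <= 1) -> 
  0 <= l <= 1 ->
  (fun z => f z.1 z.2) @ prob_filter --> l ->
  (fun p => expectation P (f p)) @ \oo --> l%:E.
Proof.
move=> mf f01 l01 fl.
have iF p : P.-integrable setT (EFin \o f p).
  apply: le_integrable (has_mean_cst P 1).1 => //.
    exact/measurable_EFinP.
  by move=> w _ /=; rewrite lee_fin normr1 ger0_norm; have /andP[] := f01 p w.
pose u p := fine (\int[P]_w (f p w)%:E).
have uE p : expectation P (f p) = (u p)%:E.
  rewrite unlock /u fineK//; apply: integrable_fin_num => //; exact: iF.
rewrite (_ : (fun p => _) = EFin \o u); last by apply/funext => p; rewrite uE.
apply: cvg_EFin; first exact: nearW.
apply/cvgrPdist_lt => e e0.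
have e20 : 0 < e / 2 by rewrite divr_gt0.
have /cvgrPdist_lt/(_ _ e20)[B [mB cB] BA] := fl.
have Bfin : (fun p => fine (P (B p))) @ \oo --> (0 : R).
  by apply: fine_cvg; exact: cB.
have /cvgr0Pnorm_lt/(_ _ e20) := Bfin.
apply: filterS => p; rewrite ger0_norm ?fine_ge0// => Be.
have h w : `|f p w - l| <= e / 2 + \1_(B p) w.
  have [Bw|Bw] := pselect (B p w).
    rewrite indicE mem_set//; apply: (@le_trans _ _ 1); last by rewrite lerDr ltW.
    by move/andP: l01 => [? ?]; have /andP[? ?] := f01 p w; rewrite ler_norml; lra.
  rewrite indicE memNset// addr0 distrC ltW//; exact: (BA _ _ Bw).
have hf : has_mean P (f p) (u p) by split => //; rewrite -uE unlock.
have hB : has_mean P (\1_(B p)) (fine (P (B p))).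
  split; last by rewrite integral_indic// setIT fineK// fin_num_measure.
  apply: le_integrable (has_mean_cst P 1).1 => //.
    exact/measurable_EFinP/measurable_indic.
  by move=> w _ /=; rewrite lee_fin normr1 indicE; case: (_ \in _); rewrite ?normr1 ?normr0.
have h1 := has_mean_ge0 _ (has_meanD (has_meanD (has_mean_cst P (e / 2)) hB)
  (has_meanD hf (has_mean_cst P (- l)))).
have h2 := has_mean_ge0 _ (has_meanD (has_meanD (has_mean_cst P (e / 2)) hB)
  (has_meanZ (-1) (has_meanD hf (has_mean_cst P (- l))))).
have {}h1 : 0 <= e / 2 + fine (P (B p)) + (u p - l).
  by apply: h1 => w; have := h w; rewrite ler_norml => /andP[]; lra.
have {}h2 : 0 <= e / 2 + fine (P (B p)) + -1 * (u p - l).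
  by apply: h2 => w; have := h w; rewrite ler_norml => /andP[]; lra.
by rewrite /= distrC ltr_norml; apply/andP; split; lra.
Qed.

End convergence_in_probability.

(** * The error estimator *)

Section Phi_theory.
Context {R : realType}.
Implicit Types x y : R.

Let PhiE x : (Phi x)%:E = normal_prob 0 1 `]-oo, x].
Proof.
rewrite /Phi fineK// ge0_fin_numE//.
exact: (le_lt_trans (probability_le1 (normal_prob 0 1) (measurable_itv `]-oo, x])) (ltry 1)).
Qed.

Lemma Phi_ge0_le1 x : 0 <= Phi x <= 1.
Proof.
rewrite -!lee_fin PhiE measure_ge0/=.
exact: (probability_le1 (normal_prob 0 1) (measurable_itv `]-oo, x])).
Qed.

(** The normal density lies between 0 and its peak value, which serves as Lipschitz constant. *)
Lemma Phi_lipschitz x y : x <= y -> 0 <= Phi y - Phi x <= normal_peak 1 * (y - x).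
Proof.
move=> xy; set k := normal_peak 1.
have e : (Phi y)%:E = ((Phi x)%:E + normal_prob 0 1 `]x, y])%E.
  rewrite !PhiE -measureU//=.
  - by congr normal_prob; rewrite -itv_bndbnd_setU// bnd_simp.
  - by apply/seteqP; split => // z [] /=; rewrite !in_itv/= => h /andP[]; rewrite ltNge h.
have le : (normal_prob 0 1 `]x, y] <= (k * (y - x))%:E)%E.
  apply: (@le_trans _ _ (\int[lebesgue_measure]_(z in `]x, y]) k%:E)%E).
    apply: ge0_le_integral => //=.
    - by move=> z _; rewrite lee_fin normal_pdf_ge0.
    - by apply/measurable_EFinP/measurable_funTS; exact: measurable_normal_pdf.
    - by move=> z _; rewrite lee_fin normal_pdf_ub// oner_eq0.
  rewrite integral_cst//= lebesgue_measure_itv/= lte_fin EFinM.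
  case: ifPn => [_|]; first by rewrite EFinB.
  by rewrite -leNgt => yx; rewrite (@le_anti _ _ x y) ?xy// subrr.
have ge : (0 <= normal_prob 0 1 `]x, y])%E by [].
by apply/andP; split; move: e le ge; case: (normal_prob _ _ _) => //= r [->];
  rewrite !lee_fin; lra.
Qed.

Lemma continuous_Phi : continuous (@Phi R).
Proof.
move=> x; set k := normal_peak 1 : R.
have k0 : 0 < k by rewrite normal_peak_gt0// oner_eq0.
have h y : `|Phi x - Phi y| <= k * `|x - y|.
  have [xy|/ltW yx] := lerP x y.
    have /andP[h1 h2] := Phi_lipschitz xy.
    by rewrite distrC ger0_norm// distrC ger0_norm ?subr_ge0.
  have /andP[h1 h2] := Phi_lipschitz yx.
  by rewrite ger0_norm// ger0_norm ?subr_ge0.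
apply/cvgrPdist_lt => e e0; near=> y.
apply: (le_lt_trans (h y)); rewrite -ltr_pdivlMl//.
by near: y; apply: cvgr_dist_lt; [exact: cvg_id|rewrite mulr_gt0// invr_gt0].
Unshelve. all: by end_near. Qed.

End Phi_theory.

Section epsB_theory.
Context {R : realType}.

Lemma measurable_qf {d} {T : measurableType d} {p : nat} (S : 'M[R]_p) (x y : T -> 'cV[R]_p) :
  (forall l, measurable_fun setT (fun w => x w l 0)) ->
  (forall l, measurable_fun setT (fun w => y w l 0)) ->
  measurable_fun setT (fun w => qf S (x w) (y w)).
Proof.
move=> mx my.
rewrite (_ : (fun w => _) = fun w => \sum_l (\sum_k x w k 0 * invmx S k l) * y w l 0).
  apply: measurable_sum => l; apply: measurable_funM => //.
  by apply: measurable_sum => k; apply: measurable_funM.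
apply/funext => w; rewrite /qf mxE; apply: eq_bigr => l _.
by rewrite mxE; congr (_ * _); apply: eq_bigr => k _; rewrite mxE.
Qed.

Lemma measurable_epsB {d} {T : measurableType d} {p : nat} (S : 'M[R]_p) (c : R)
  (i : bool) (m : 'cV[R]_p) (nu : R) (n : nat) (xi x0 x1 : T -> 'cV[R]_p) :
  (forall l, measurable_fun setT (fun w => xi w l 0)) ->
  (forall l, measurable_fun setT (fun w => x0 w l 0)) ->
  (forall l, measurable_fun setT (fun w => x1 w l 0)) ->
  measurable_fun setT (fun w => epsB_i S c i m nu n (xi w) (x0 w) (x1 w)).
Proof.
move=> mi m0 m1; apply: measurableT_comp.
  exact: continuous_measurable_fun continuous_Phi.
have mB l : measurable_fun setT (fun w => (x0 w - x1 w) l 0).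
  by under eq_fun do rewrite !mxE; exact: measurable_funB.
have mS l : measurable_fun setT
    (fun w => ((n%:R + nu)^-1 *: (n%:R *: xi w + nu *: m) - 2^-1 *: (x0 w + x1 w)) l 0).
  under eq_fun do rewrite !mxE.
  apply: measurable_funB; apply: measurable_funM => //.
    by apply: measurable_funD => //; apply: measurable_funM.
  exact: measurable_funD.
apply: measurable_funM => //; apply: measurable_funM => //; apply: measurable_funM.
  apply: measurable_funD => //; apply: measurableT_comp => //.
  exact: measurable_qf.
(* [x `^ (-1)] is [x^-1] for every [x >= 0], including the value 0 at 0. *)
rewrite (_ : (fun w => _) = fun w => Num.sqrt (qf S (x0 w - x1 w) (x0 w - x1 w)) `^ (-1)).
  apply: (measurableT_comp (measurable_powR (-1))).
  apply: (measurableT_comp (f := @Num.sqrt R)); last exact: measurable_qf.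
  by apply: continuous_measurable_fun; exact: sqrt_continuous.
by apply/funext => w; rewrite powR_inv1// sqrtr_ge0.
Qed.

Lemma epsB_ge0_le1 {p : nat} (S : 'M[R]_p) c i m nu n (xi x0 x1 : 'cV[R]_p) :
  0 <= epsB_i S c i m nu n xi x0 x1 <= 1.
Proof. exact: Phi_ge0_le1. Qed.

(** Free of probability: the estimator is a continuous function of finitely many scalars, along any
    filter and with a varying dimension. The square root factor tends to 1 because [nustar] is at
    least [n]; positivity of the limit of the squared distance permits the division. Keeping [xi]
    apart from [x0] and [x1] serves both classes. *)
Lemma epsB_cvg {Z : Type} (F : set_system Z) {FF : Filter F} (dim : Z -> nat)
  (S : forall z, 'M[R]_(dim z)) (c : R) (i : bool) (m xi x0 x1 : forall z, 'cV[R]_(dim z))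
  (nu : Z -> R) (n : Z -> nat) (gamma A0 A1 B0 B1 C00 C01 C11 : R) :
  (forall z, sym_pd (S z)) -> (forall z, 0 < nu z) ->
  (fun z => (n z)%:R : R) @ F --> +oo ->
  0 <= gamma -> (fun z => nu z / (n z)%:R) @ F --> gamma ->
  (fun z => qf (S z) (xi z) (x0 z)) @ F --> A0 ->
  (fun z => qf (S z) (xi z) (x1 z)) @ F --> A1 ->
  (fun z => qf (S z) (m z) (x0 z)) @ F --> B0 ->
  (fun z => qf (S z) (m z) (x1 z)) @ F --> B1 ->
  (fun z => qf (S z) (x0 z) (x0 z)) @ F --> C00 ->
  (fun z => qf (S z) (x0 z) (x1 z)) @ F --> C01 ->
  (fun z => qf (S z) (x1 z) (x1 z)) @ F --> C11 ->
  0 < C00 - 2 * C01 + C11 ->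
  (fun z => epsB_i (S z) c i (m z) (nu z) (n z) (xi z) (x0 z) (x1 z)) @ F -->
  Phi ((-1) ^+ i * ((- ((1 + gamma)^-1 * (A0 - A1 + gamma * (B0 - B1)) - 2^-1 * (C00 - C11)) + c)
    / Num.sqrt (C00 - 2 * C01 + C11))).
Proof.
move=> pdS nu0 ninf g0 nug hA0 hA1 hB0 hB1 hC00 hC01 hC11 D0.
have g1 : 1 + gamma != 0 by rewrite gt_eqF// ltr_wpDr.
apply: continuous_cvg; first exact: continuous_Phi.
apply: cvgMl_tmp.
rewrite -[X in _ --> X]mulr1; apply: cvgM; last first.
  rewrite -[X in _ --> X]sqrtr1; apply: continuous_cvg; first exact: sqrt_continuous.
  have -> : (fun z => ((n z)%:R + nu z) / ((n z)%:R + nu z + 1)) =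
      (fun z => 1 - ((n z)%:R + nu z + 1)^-1).
    apply/funext => z; field; rewrite gt_eqF// ltr_wpDl// addr_ge0// ltW//.
  rewrite -[X in _ --> X]subr0; apply: cvgB; first exact: cvg_cst.
  apply/gtr0_cvgV0.
    by apply: nearW => z; rewrite ltr_wpDl// addr_ge0// ltW//.
  apply: ger_cvgy ninf; apply: nearW => z.
  by rewrite -addrA lerDl addr_ge0// ltW//.
apply: cvgM; last first.
  apply: cvgV; first by rewrite gt_eqF// sqrtr_gt0.
  apply: continuous_cvg; first exact: sqrt_continuous.
  rewrite (_ : (fun z => qf (S z) (x0 z - x1 z) (x0 z - x1 z)) = fun z =>
    qf (S z) (x0 z) (x0 z) - 2 * qf (S z) (x0 z) (x1 z) + qf (S z) (x1 z) (x1 z)).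
    by apply: cvgD => //; apply: cvgB => //; apply: cvgMl_tmp.
  apply/funext => z; rewrite !(qfDr (pdS z), qfNr (pdS z), qfDl, qfNl).
  by rewrite (qfC (pdS z) (x1 z) (x0 z)); ring.
apply: cvgD; last exact: cvg_cst.
apply: cvgN.
(* Numerator and denominator of [mstar] are divided by [n], nonzero eventually, so that only the
   ratio [nu / n] remains. *)
apply: (@cvg_trans _ ((fun z => (1 + nu z / (n z)%:R)^-1 *
   (qf (S z) (xi z) (x0 z) - qf (S z) (xi z) (x1 z)
    + nu z / (n z)%:R * (qf (S z) (m z) (x0 z) - qf (S z) (m z) (x1 z)))
   - 2^-1 * (qf (S z) (x0 z) (x0 z) - qf (S z) (x1 z) (x1 z))) @ F)).
  apply: near_eq_cvg; near=> z.
  have n0 : 0 < (n z)%:R :> R by near: z; move/cvgryPgt : ninf; exact.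
  rewrite !(qfDr (pdS z), qfNr (pdS z), qfDl, qfNl, qfZl).
  rewrite (qfC (pdS z) (x1 z) (x0 z)).
  have := nu0 z => nz; field; rewrite !gt_eqF//= addr_gt0//.
apply: cvgB.
  apply: cvgM.
    by apply: cvgV => //; apply: cvgD => //; exact: cvg_cst.
  by apply: cvgD; [exact: cvgB|apply: cvgM => //; exact: cvgB].
by apply: cvgMl_tmp; exact: cvgB.
Unshelve. all: by end_near. Qed.

End epsB_theory.

(** * Asymptotics of the sample means *)

Section sample_forms.
Context {R : realType} {d} {T : measurableType d}.
Variable P : probability T R.

(** Brings the centred mean into the shape of a weighted sum. For [n = 0] the left side is 0 while
    the right side is [- u *: mu]. *)
Lemma smean_centered {p n : nat} (X : 'I_n -> T -> 'cV[R]_p) mu w (u : R) : (0 < n)%N ->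
  \sum_(j < n) (u / n%:R) *: (X j w - mu) = u *: (smean X w - mu).
Proof.
move=> n0; have n1 : n%:R != 0 :> R by rewrite pnatr_eq0 -lt0n.
rewrite -scaler_sumr sumrB sumr_const card_ord /smean scalerBr [RHS]scalerBr scalerA.
by rewrite -(scaler_nat n mu) scalerA divfK.
Qed.

Lemma measurable_smean {p n : nat} (X : 'I_n -> T -> 'cV[R]_p) (l : 'I_p) :
  (forall j, measurable_fun setT (fun w => X j w l 0)) ->
  measurable_fun setT (fun w => smean X w l 0).
Proof.
move=> mX; under eq_fun do rewrite mxE summxE.
by apply: measurable_funM => //; exact: measurable_sum.
Qed.

Section fixed_dimension.
Variables (p n0 n1 : nat) (S : 'M[R]_p) (mu0 mu1 : 'cV[R]_p).
Variables (X0 : 'I_n0 -> T -> 'cV[R]_p) (X1 : 'I_n1 -> T -> 'cV[R]_p).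
Hypothesis pdS : sym_pd S.
Hypothesis g0 : forall j, gaussian_vec P (X0 j) mu0 S.
Hypothesis g1 : forall j, gaussian_vec P (X1 j) mu1 S.
Hypothesis iX : indep_vecs P (sample_family X0 X1).
Hypotheses (n0_gt0 : (0 < n0)%N) (n1_gt0 : (0 < n1)%N).

Let W (u v : R) w := u *: (smean X0 w - mu0) + v *: (smean X1 w - mu1).
Let s (u v : R) : R := u ^+ 2 / n0%:R + v ^+ 2 / n1%:R.

(** Both samples are one independent family over a sum type, with weights [u / n0] and [v / n1]; the
    squared weights add up to [s u v]. Free [u] and [v] cover each mean alone and, by polarization,
    their cross term. *)
Let form_moments u v a :
  has_mean P (fun w => (a^T *m W u v w) 0 0 ^+ 2) (s u v * covf S a a) /\
  has_mean P (fun w => (a^T *m W u v w) 0 0 ^+ 4) (3 * (s u v * covf S a a) ^+ 2).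
Proof.
pose M (k : 'I_n0 + 'I_n1) := match k with inl _ => mu0 | inr _ => mu1 end.
pose c (k : 'I_n0 + 'I_n1) : R := match k with inl _ => u / n0%:R | inr _ => v / n1%:R end.
have gX k : gaussian_vec P (sample_family X0 X1 k) (M k) S by case: k.
have [_ h2 h4] := weighted_form_moments pdS c gX iX a (index_enum_uniq ('I_n0 + 'I_n1)%type).
have eW w : \sum_k c k * centered_form (sample_family X0 X1 k) (M k) a w =
    (a^T *m W u v w) 0 0.
  rewrite /W -!smean_centered// big_sumType/= mulmxDr mxE !mulmx_sumr !summxE.
  by congr (_ + _); apply: eq_bigr => j _; rewrite -scalemxAr [RHS]mxE.
have es : \sum_k c k ^+ 2 = s u v.
  have n0' : n0%:R != 0 :> R by rewrite pnatr_eq0 -lt0n.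
  have n1' : n1%:R != 0 :> R by rewrite pnatr_eq0 -lt0n.
  rewrite big_sumType/= !sumr_const !card_ord -(mulr_natr (_ ^+ 2)) -(mulr_natr ((v / _) ^+ 2)).
  by rewrite /s; field; rewrite n0' n1'.
split.
  by apply: (eq_has_mean h2) => [w|]; rewrite ?eW ?es.
by apply: (eq_has_mean h4) => [w|]; rewrite ?eW ?es.
Qed.

Lemma has_mean_sample_qf_sqr u v : let s := u ^+ 2 / n0%:R + v ^+ 2 / n1%:R in
  has_mean P (fun w =>
    (qf S (u *: (smean X0 w - mu0) + v *: (smean X1 w - mu1))
          (u *: (smean X0 w - mu0) + v *: (smean X1 w - mu1)) - s * p%:R) ^+ 2)
    (2 * p%:R * s ^+ 2).
Proof.
move=> s'.
exact: (has_mean_qf_sqr pdS (fun a => (form_moments u v a).1) (fun a => (form_moments u v a).2)).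
Qed.

Lemma has_mean_sample_qf_linear u v b : let s := u ^+ 2 / n0%:R + v ^+ 2 / n1%:R in
  has_mean P (fun w =>
    (qf S b (u *: (smean X0 w - mu0) + v *: (smean X1 w - mu1))) ^+ 2) (s * qf S b b).
Proof.
move=> s'; exact: (has_mean_qf_linear pdS (fun a => (form_moments u v a).1) b).
Qed.

End fixed_dimension.
End sample_forms.

Section asymptotics.
Context {R : realType} {d} {T : measurableType d}.
Variable P : probability T R.
Variables (S : forall p : nat, 'M[R]_p) (mu0 mu1 : forall p : nat, 'cV[R]_p).
Variables (n0 n1 : nat -> nat) (J0 J1 : R).
Variables (X0 : forall p : nat, 'I_(n0 p) -> T -> 'cV[R]_p)
  (X1 : forall p : nat, 'I_(n1 p) -> T -> 'cV[R]_p).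
Arguments X0 : clear implicits.
Arguments X1 : clear implicits.
Hypothesis pdS : forall p, sym_pd (S p).
Hypothesis g0 : forall p j, gaussian_vec P (X0 p j) (mu0 p) (S p).
Hypothesis g1 : forall p j, gaussian_vec P (X1 p j) (mu1 p) (S p).
Hypothesis iX : forall p, indep_vecs P (sample_family (X0 p) (X1 p)).
Hypothesis n0y : (fun p => (n0 p)%:R : R) @ \oo --> +oo.
Hypothesis n1y : (fun p => (n1 p)%:R : R) @ \oo --> +oo.
Hypothesis pn0 : (fun p => p%:R / (n0 p)%:R : R) @ \oo --> J0.
Hypothesis pn1 : (fun p => p%:R / (n1 p)%:R : R) @ \oo --> J1.

Local Notation F := (prob_filter P).
Let Y0 (p : nat) (w : T) : 'cV[R]_p := smean (X0 p) w - mu0 p.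
Let Y1 (p : nat) (w : T) : 'cV[R]_p := smean (X1 p) w - mu1 p.

Let mX0 p l : measurable_fun setT (fun w => smean (X0 p) w l 0).
Proof. by apply: measurable_smean => j; have [] := g0 j. Qed.

Let mX1 p l : measurable_fun setT (fun w => smean (X1 p) w l 0).
Proof. by apply: measurable_smean => j; have [] := g1 j. Qed.

Let mW u v p (l : 'I_p) :
  measurable_fun setT (fun w => (u *: Y0 p w + v *: Y1 p w) l 0).
Proof.
have mY0 : measurable_fun setT (fun w => Y0 p w l 0).
  rewrite (_ : (fun w => _) = fun w => smean (X0 p) w l 0 - mu0 p l 0).
    by apply: measurable_funB => //; exact: mX0.
  by apply/funext => w; rewrite /Y0 !mxE.
have mY1 : measurable_fun setT (fun w => Y1 p w l 0).
  rewrite (_ : (fun w => _) = fun w => smean (X1 p) w l 0 - mu1 p l 0).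
    by apply: measurable_funB => //; exact: mX1.
  by apply/funext => w; rewrite /Y1 !mxE.
rewrite (_ : (fun w => _) = fun w => u * Y0 p w l 0 + v * Y1 p w l 0).
  by apply: measurable_funD; exact: measurable_funM.
by apply/funext => w; rewrite [LHS]mxE; congr (_ + _); rewrite [LHS]mxE.
Qed.

Let inv_n0 : (fun p => (n0 p)%:R^-1 : R) @ \oo --> 0.
Proof.
by apply/gtr0_cvgV0 => //; move/cvgryPgt : n0y; exact.
Qed.

Let inv_n1 : (fun p => (n1 p)%:R^-1 : R) @ \oo --> 0.
Proof.
by apply/gtr0_cvgV0 => //; move/cvgryPgt : n1y; exact.
Qed.

Let near_gt0 : \forall p \near \oo, (0 < n0 p)%N /\ (0 < n1 p)%N.
Proof.
near=> p; split; rewrite -(ltr_nat R).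
  by near: p; move/cvgryPgt : n0y; exact.
by near: p; move/cvgryPgt : n1y; exact.
Unshelve. all: by end_near. Qed.

(** The mean [s p * p] converges to the stated limit; the variance is twice this mean times [s p],
    and [s p] tends to 0. *)
Lemma cvg_qf_centered u v :
  (fun z => qf (S z.1) (u *: Y0 z.1 z.2 + v *: Y1 z.1 z.2) (u *: Y0 z.1 z.2 + v *: Y1 z.1 z.2)) @ F -->
  u ^+ 2 * J0 + v ^+ 2 * J1.
Proof.
pose s p : R := u ^+ 2 / (n0 p)%:R + v ^+ 2 / (n1 p)%:R.
have sp : (fun p => s p * p%:R) @ \oo --> u ^+ 2 * J0 + v ^+ 2 * J1.
  rewrite (_ : (fun p => _) = fun p =>
      u ^+ 2 * (p%:R / (n0 p)%:R) + v ^+ 2 * (p%:R / (n1 p)%:R)).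
    by apply: cvgD; exact: cvgMl_tmp.
  by apply/funext => p; rewrite /s; ring.
apply: (cvg_prob_chebyshev (f := fun p w =>
    qf (S p) (u *: Y0 p w + v *: Y1 p w) (u *: Y0 p w + v *: Y1 p w))
  (l := fun p => s p * p%:R) (v := fun p => 2 * p%:R * s p ^+ 2)) => //.
- by move=> p; exact: measurable_qf.
- near=> p.
  have [n0_gt0 n1_gt0] : (0 < n0 p)%N /\ (0 < n1 p)%N by near: p.
  exact: (has_mean_sample_qf_sqr (pdS p) (@g0 p) (@g1 p) (@iX p)).
- rewrite (_ : (fun p => _) = fun p => 2 * (s p * p%:R) * s p); last first.
    by apply/funext => p; ring.
  rewrite -[X in _ --> X](mulr0 (2 * (u ^+ 2 * J0 + v ^+ 2 * J1))).
  apply: cvgM; first exact: cvgMl_tmp.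
  rewrite -(addr0 0) -[X in X + _](mulr0 (u ^+ 2)) -[X in _ + X](mulr0 (v ^+ 2)).
  by apply: cvgD; exact: cvgMl_tmp.
Unshelve. all: by end_near. Qed.

(** A fixed direction does not see the dimension: the second moment is [s p] times a convergent
    sequence. *)
Lemma cvg_qf_linear u v (b : forall p : nat, 'cV[R]_p) :
  cvg ((fun p => qf (S p) (b p) (b p)) @ \oo) ->
  (fun z => qf (S z.1) (b z.1) (u *: Y0 z.1 z.2 + v *: Y1 z.1 z.2)) @ F --> (0 : R).
Proof.
move=> /cvg_ex[/= q bq].
pose s p : R := u ^+ 2 / (n0 p)%:R + v ^+ 2 / (n1 p)%:R.
apply: (cvg_prob_chebyshev (f := fun p w => qf (S p) (b p) (u *: Y0 p w + v *: Y1 p w))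
  (l := fun=> 0) (v := fun p => s p * qf (S p) (b p) (b p))) => //.
- by move=> p; apply: measurable_qf => //.
- near=> p.
  have [n0_gt0 n1_gt0] : (0 < n0 p)%N /\ (0 < n1 p)%N by near: p.
  apply: (eq_has_mean (has_mean_sample_qf_linear (pdS p) (@g0 p) (@g1 p) (@iX p)
    n0_gt0 n1_gt0 u v (b p))) => // w.
  by rewrite subr0.
- rewrite -[X in _ --> X](mul0r q); apply: cvgM => //.
  rewrite -(addr0 0) -[X in X + _](mulr0 (u ^+ 2)) -[X in _ + X](mulr0 (v ^+ 2)).
  by apply: cvgD; exact: cvgMl_tmp.
- exact: cvg_cst.
Unshelve. all: by end_near. Qed.

Let x0 (z : nat * T) := smean (X0 z.1) z.2.
Let x1 (z : nat * T) := smean (X1 z.1) z.2.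
Let x0E z : x0 z = mu0 z.1 + (1 *: Y0 z.1 z.2 + 0 *: Y1 z.1 z.2).
Proof. by rewrite scale1r scale0r addr0 /Y0 addrC subrK. Qed.
Let x1E z : x1 z = mu1 z.1 + (0 *: Y0 z.1 z.2 + 1 *: Y1 z.1 z.2).
Proof. by rewrite scale1r scale0r add0r /Y1 addrC subrK. Qed.

Lemma cvg_qf_x0 (b : forall p : nat, 'cV[R]_p) (q : R) :
  cvg ((fun p => qf (S p) (b p) (b p)) @ \oo) ->
  (fun p => qf (S p) (b p) (mu0 p)) @ \oo --> q ->
  (fun z => qf (S z.1) (b z.1) (x0 z)) @ F --> q.
Proof.
move=> bb bq; rewrite -[q]addr0 (_ : (fun z => _) = fun z => qf (S z.1) (b z.1) (mu0 z.1) +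
    qf (S z.1) (b z.1) (1 *: Y0 z.1 z.2 + 0 *: Y1 z.1 z.2)).
  by apply: cvgD; [exact: (cvg_prob_seq _ bq)|exact: cvg_qf_linear].
by apply/funext => z; rewrite x0E (qfDr (pdS _)).
Qed.

Lemma cvg_qf_x1 (b : forall p : nat, 'cV[R]_p) (q : R) :
  cvg ((fun p => qf (S p) (b p) (b p)) @ \oo) ->
  (fun p => qf (S p) (b p) (mu1 p)) @ \oo --> q ->
  (fun z => qf (S z.1) (b z.1) (x1 z)) @ F --> q.
Proof.
move=> bb bq; rewrite -[q]addr0 (_ : (fun z => _) = fun z => qf (S z.1) (b z.1) (mu1 z.1) +
    qf (S z.1) (b z.1) (0 *: Y0 z.1 z.2 + 1 *: Y1 z.1 z.2)).
  by apply: cvgD; [exact: (cvg_prob_seq _ bq)|exact: cvg_qf_linear].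
by apply/funext => z; rewrite x1E (qfDr (pdS _)).
Qed.

Lemma cvg_qf_x0x0 (q : R) : (fun p => qf (S p) (mu0 p) (mu0 p)) @ \oo --> q ->
  (fun z => qf (S z.1) (x0 z) (x0 z)) @ F --> q + J0.
Proof.
move=> h; have hc : cvg ((fun p => qf (S p) (mu0 p) (mu0 p)) @ \oo) by apply/cvg_ex; exists q.
(* The limit is rewritten along the expansion of the squared norm of [x0] about [mu0]: twice the
   form of [mu0] and [x0], minus that of [mu0] with itself, plus the centred part with weights 1 and
   0. *)
have -> : q + J0 = 2 * q - q + (1 ^+ 2 * J0 + 0 ^+ 2 * J1) by ring.
rewrite (_ : (fun z => _) = fun z => 2 * qf (S z.1) (mu0 z.1) (x0 z) -
  qf (S z.1) (mu0 z.1) (mu0 z.1) +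
  qf (S z.1) (1 *: Y0 z.1 z.2 + 0 *: Y1 z.1 z.2) (1 *: Y0 z.1 z.2 + 0 *: Y1 z.1 z.2)).
  apply: cvgD; last exact: cvg_qf_centered.
  apply: cvgB; first by apply: cvgMl_tmp; exact: cvg_qf_x0.
  exact: (cvg_prob_seq _ h).
apply/funext => z; rewrite x0E; move: (_ *: _ + _) => y.
by rewrite !(qfDr (pdS _), qfDl) (qfC (pdS _) y); ring.
Qed.

Lemma cvg_qf_x1x1 (q : R) : (fun p => qf (S p) (mu1 p) (mu1 p)) @ \oo --> q ->
  (fun z => qf (S z.1) (x1 z) (x1 z)) @ F --> q + J1.
Proof.
move=> h; have hc : cvg ((fun p => qf (S p) (mu1 p) (mu1 p)) @ \oo) by apply/cvg_ex; exists q.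
have -> : q + J1 = 2 * q - q + (0 ^+ 2 * J0 + 1 ^+ 2 * J1) by ring.
rewrite (_ : (fun z => _) = fun z => 2 * qf (S z.1) (mu1 z.1) (x1 z) -
  qf (S z.1) (mu1 z.1) (mu1 z.1) +
  qf (S z.1) (0 *: Y0 z.1 z.2 + 1 *: Y1 z.1 z.2) (0 *: Y0 z.1 z.2 + 1 *: Y1 z.1 z.2)).
  apply: cvgD; last exact: cvg_qf_centered.
  apply: cvgB; first by apply: cvgMl_tmp; exact: cvg_qf_x1.
  exact: (cvg_prob_seq _ h).
apply/funext => z; rewrite x1E; move: (_ *: _ + _) => y.
by rewrite !(qfDr (pdS _), qfDl) (qfC (pdS _) y); ring.
Qed.

(* The cross term of the two centred means tends to 0: polarize the squared
   norms with weights (1,0), (0,1) and (1,1). *)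
Lemma cvg_qf_x0x1 (q : R) : (fun p => qf (S p) (mu0 p) (mu1 p)) @ \oo --> q ->
  cvg ((fun p => qf (S p) (mu0 p) (mu0 p)) @ \oo) ->
  cvg ((fun p => qf (S p) (mu1 p) (mu1 p)) @ \oo) ->
  (fun z => qf (S z.1) (x0 z) (x1 z)) @ F --> q.
Proof.
move=> h h0 h1.
have h' : (fun p => qf (S p) (mu1 p) (mu0 p)) @ \oo --> q.
  by under eq_fun do rewrite (qfC (pdS _)).
have -> : q = q + q - q + 2^-1 * ((1 ^+ 2 * J0 + 1 ^+ 2 * J1) -
  ((1 ^+ 2 * J0 + 0 ^+ 2 * J1) + (0 ^+ 2 * J0 + 1 ^+ 2 * J1))) by field.
rewrite (_ : (fun z => _) = fun z => qf (S z.1) (mu0 z.1) (x1 z) + qf (S z.1) (mu1 z.1) (x0 z) -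
  qf (S z.1) (mu0 z.1) (mu1 z.1) + 2^-1 * (
  qf (S z.1) (1 *: Y0 z.1 z.2 + 1 *: Y1 z.1 z.2) (1 *: Y0 z.1 z.2 + 1 *: Y1 z.1 z.2) -
  (qf (S z.1) (1 *: Y0 z.1 z.2 + 0 *: Y1 z.1 z.2) (1 *: Y0 z.1 z.2 + 0 *: Y1 z.1 z.2) +
   qf (S z.1) (0 *: Y0 z.1 z.2 + 1 *: Y1 z.1 z.2) (0 *: Y0 z.1 z.2 + 1 *: Y1 z.1 z.2)))).
  apply: cvgD; last first.
    by apply: cvgMl_tmp; apply: cvgB; [|apply: cvgD]; exact: cvg_qf_centered.
  apply: cvgB; last exact: (cvg_prob_seq _ h).
  by apply: cvgD; [exact: cvg_qf_x1|exact: cvg_qf_x0].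
apply/funext => z; rewrite x0E x1E !scale1r !scale0r !addr0 !add0r.
move: (Y0 z.1 z.2) (Y1 z.1 z.2) => y0 y1.
rewrite !(qfDr (pdS _), qfDl) (qfC (pdS _) y0 (mu1 z.1)) (qfC (pdS _) y1 y0).
by rewrite (qfC (pdS _) (mu1 z.1) (mu0 z.1)); field.
Qed.

End asymptotics.

Theorem theorem1 (R : realType) (d : measure_display) (T : measurableType d)
  (P : probability T R) (alpha0 : R)
  (Sigma : forall p : nat, 'M[R]_p)
  (mu0 mu1 m0 m1 : forall p : nat, 'cV[R]_p)
  (n0 n1 : nat -> nat) (nu0 nu1 : nat -> R)
  (J0 J1 gamma0 gamma1 : R)
  (X0 : forall p : nat, 'I_(n0 p) -> T -> 'cV[R]_p)
  (X1 : forall p : nat, 'I_(n1 p) -> T -> 'cV[R]_p) :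
  0 < alpha0 < 1 ->
  (forall p, sym_pd (Sigma p)) ->
  (forall p, 0 < nu0 p) -> (forall p, 0 < nu1 p) ->
  (forall p j, gaussian_vec P (X0 p j) (mu0 p) (Sigma p)) ->
  (forall p j, gaussian_vec P (X1 p j) (mu1 p) (Sigma p)) ->
  (forall p, indep_vecs P (sample_family (X0 p) (X1 p))) ->
  (fun p => (n0 p)%:R : R) @ \oo --> +oo ->
  (fun p => (n1 p)%:R : R) @ \oo --> +oo ->
  nu0 @ \oo --> +oo ->
  nu1 @ \oo --> +oo ->
  0 <= J0 -> 0 <= J1 ->
  (fun p => p%:R / (n0 p)%:R : R) @ \oo --> J0 ->
  (fun p => p%:R / (n1 p)%:R : R) @ \oo --> J1 ->
  0 <= gamma0 -> 0 <= gamma1 ->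
  (fun p => nu0 p / (n0 p)%:R) @ \oo --> gamma0 ->
  (fun p => nu1 p / (n1 p)%:R) @ \oo --> gamma1 ->
  (forall f g : forall p : nat, 'cV[R]_p,
      (f = m0 \/ f = m1 \/ f = mu0 \/ f = mu1) ->
      (g = m0 \/ g = m1 \/ g = mu0 \/ g = mu1) ->
      cvg ((fun p => qf (Sigma p) (f p) (g p)) @ \oo)) ->
  let alpha1 := 1 - alpha0 in
  let c := ln ((1 - alpha0) / alpha0) in
  let etabar (a b : forall p : nat, 'cV[R]_p) :=
    lim ((fun p => etaS (Sigma p) (a p) (b p)) @ \oo) in
  let deltabar2 := etabar mu0 mu1 in
  let D := deltabar2 + J0 + J1 in
  0 < D ->
  let G0B := (2 * (1 + gamma0))^-1 *
    (gamma0 * (etabar m0 mu1 - etabar m0 mu0) + deltabar2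
     + (1 - gamma0) * J0 + (1 + gamma0) * J1) in
  let G1B := - (2 * (1 + gamma1))^-1 *
    (gamma1 * (etabar m1 mu0 - etabar m1 mu1) + deltabar2
     + (1 - gamma1) * J1 + (1 + gamma1) * J0) in
  let eB0 p w := epsB_i (Sigma p) c false (m0 p) (nu0 p) (n0 p)
                   (smean (X0 p) w) (smean (X0 p) w) (smean (X1 p) w) in
  let eB1 p w := epsB_i (Sigma p) c true (m1 p) (nu1 p) (n1 p)
                   (smean (X1 p) w) (smean (X0 p) w) (smean (X1 p) w) in
  ((fun p => expectation P (eB0 p)) @ \oo --> (Phi ((- G0B + c) / Num.sqrt D))%:E) /\
  ((fun p => expectation P (eB1 p)) @ \oo -->
     (Phi ((-1) * ((- G1B + c) / Num.sqrt D)))%:E) /\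
  ((fun p => expectation P (fun w => alpha0 * eB0 p w + alpha1 * eB1 p w)) @ \oo -->
     (alpha0 * Phi ((- G0B + c) / Num.sqrt D)
      + alpha1 * Phi ((G1B - c) / Num.sqrt D))%:E).
Proof.
move=> alpha01 pdS nu0_gt0 nu1_gt0 g0 g1 iX n0y n1y _ _ _ _ pn0 pn1 gm0 gm1 nun0 nun1 hqf.
move=> alpha1 c etabar deltabar2 D D_gt0 G0B G1B eB0 eB1.
pose q (f g : forall p : nat, 'cV[R]_p) := lim ((fun p => qf (Sigma p) (f p) (g p)) @ \oo).
pose is_param (f : forall p : nat, 'cV[R]_p) := f = m0 \/ f = m1 \/ f = mu0 \/ f = mu1.
have p_m0 : is_param m0 by left.
have p_m1 : is_param m1 by right; left.
have p_mu0 : is_param mu0 by right; right; left.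
have p_mu1 : is_param mu1 by right; right; right.
have hq f g : is_param f -> is_param g ->
  (fun p => qf (Sigma p) (f p) (g p)) @ \oo --> q f g by exact: hqf.
have etabarE f g : is_param f -> is_param g -> etabar f g = q f f - 2 * q f g + q g g.
  move=> pf pg; apply: cvg_lim => //.
  rewrite (_ : (fun p => _) = fun p => qf (Sigma p) (f p) (f p) - 2 * qf (Sigma p) (f p) (g p) +
      qf (Sigma p) (g p) (g p)).
    by apply: cvgD; [apply: cvgB; [|apply: cvgMl_tmp]|]; exact: hq.
  apply/funext => p; rewrite /etaS !(qfDr (pdS p), qfNr (pdS p), qfDl, qfNl).
  by rewrite (qfC (pdS p) (g p) (f p)); ring.
have DE : D = (q mu0 mu0 + J0) - 2 * q mu0 mu1 + (q mu1 mu1 + J1).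
  by rewrite /D /deltabar2 etabarE//; ring.
have x0x0 := cvg_qf_x0x0 pdS g0 g1 iX n0y n1y pn0 pn1 (hq _ _ p_mu0 p_mu0).
have x1x1 := cvg_qf_x1x1 pdS g0 g1 iX n0y n1y pn0 pn1 (hq _ _ p_mu1 p_mu1).
have x0x1 := cvg_qf_x0x1 pdS g0 g1 iX n0y n1y pn0 pn1 (hq _ _ p_mu0 p_mu1)
  (hqf _ _ p_mu0 p_mu0) (hqf _ _ p_mu1 p_mu1).
have bx0 b (pb : is_param b) := cvg_qf_x0 pdS g0 g1 iX n0y n1y (hqf _ _ pb pb) (hq _ _ pb p_mu0).
have bx1 b (pb : is_param b) := cvg_qf_x1 pdS g0 g1 iX n0y n1y (hqf _ _ pb pb) (hq _ _ pb p_mu1).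
have x1x0 : (fun z => qf (Sigma z.1) (smean (X1 z.1) z.2) (smean (X0 z.1) z.2)) @ prob_filter P -->
    q mu0 mu1.
  by under eq_fun do rewrite (qfC (pdS _)).
have D0 : 0 < (q mu0 mu0 + J0) - 2 * q mu0 mu1 + (q mu1 mu1 + J1) by rewrite -DE.
have n0yF : (fun z : nat * T => (n0 z.1)%:R : R) @ prob_filter P --> +oo.
  exact: (cvg_comp _ _ (prob_filter_fst P) n0y).
have n1yF : (fun z : nat * T => (n1 z.1)%:R : R) @ prob_filter P --> +oo.
  exact: (cvg_comp _ _ (prob_filter_fst P) n1y).
have c0 : (fun z => eB0 z.1 z.2) @ prob_filter P --> Phi ((- G0B + c) / Num.sqrt D).
  (* For class 0, [xi] is the first sample mean, so [x0x0] and [x0x1] are supplied twice. *)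
  have := epsB_cvg (FF := prob_filter_filter P) (c := c) (i := false) (fun z => pdS z.1) (fun z => nu0_gt0 z.1) n0yF
    gm0 (cvg_prob_seq P nun0) x0x0 x0x1 (bx0 _ p_m0) (bx1 _ p_m0) x0x0 x0x1 x1x1 D0.
  (* Over the denominator [2 (1 + gamma0)], [J0] gets 2 from the posterior mean and [- (1 + gamma0)]
     from the midpoint, which gives [1 - gamma0]. The square of [m0] cancels in the difference of
     the two [etabar]. *)
  rewrite -DE expr0 mul1r (_ : _ - _ = G0B)//.
  rewrite /G0B /deltabar2 !etabarE//; field.
  by rewrite gt_eqF// ltr_wpDr.
have c1 : (fun z => eB1 z.1 z.2) @ prob_filter P --> Phi ((-1) * ((- G1B + c) / Num.sqrt D)).
  have := epsB_cvg (FF := prob_filter_filter P) (c := c) (i := true) (fun z => pdS z.1) (fun z => nu1_gt0 z.1) n1yF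
    gm1 (cvg_prob_seq P nun1) x1x0 x1x1 (bx0 _ p_m1) (bx1 _ p_m1) x0x0 x0x1 x1x1 D0.
  rewrite -DE expr1 (_ : _ - _ = G1B)//.
  rewrite /G1B /deltabar2 !etabarE//; field.
  by rewrite gt_eqF// ltr_wpDr.
have mx0 p l : measurable_fun setT (fun w => smean (X0 p) w l 0).
  by apply: measurable_smean => j; have [] := g0 p j.
have mx1 p l : measurable_fun setT (fun w => smean (X1 p) w l 0).
  by apply: measurable_smean => j; have [] := g1 p j.
have me0 p : measurable_fun setT (eB0 p) by exact: measurable_epsB.
have me1 p : measurable_fun setT (eB1 p) by exact: measurable_epsB.
have b0 p w : 0 <= eB0 p w <= 1 by exact: epsB_ge0_le1.
have b1 p w : 0 <= eB1 p w <= 1 by exact: epsB_ge0_le1.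
have convex01 x y : 0 <= x <= 1 -> 0 <= y <= 1 -> 0 <= alpha0 * x + alpha1 * y <= 1.
  by rewrite /alpha1; case/andP: alpha01 => ? ? /andP[? ?] /andP[? ?]; apply/andP; split; nra.
have e1 : Phi ((G1B - c) / Num.sqrt D) = Phi ((-1) * ((- G1B + c) / Num.sqrt D)).
  by congr Phi; ring.
split; [|split].
- by apply: bounded_cvg_prob_expectation => //; exact: Phi_ge0_le1.
- by apply: bounded_cvg_prob_expectation => //; exact: Phi_ge0_le1.
(* The convex combination takes values in the unit interval, so its limit in probability is taken
   directly, without splitting the expectation. *)
- rewrite e1; apply: (bounded_cvg_prob_expectation
    (f := fun p w => alpha0 * eB0 p w + alpha1 * eB1 p w)).
  + by move=> p; apply: measurable_funD; exact: measurable_funM.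
  + by move=> p w; exact: convex01.
  + by apply: convex01; exact: Phi_ge0_le1.
  + by apply: cvgD; exact: cvgMl_tmp.
Qed.
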